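(* Let $q$ be a power of a prime $p \neq 2,3$. Let $\Psi$ be the set of ordered pairs $(\mathcal A,\mathcal B)$ of nonsingular conics in $\mathbb P^2(\mathbb F_q)$ such that $\overline{\mathcal A}$ and $\overline{\mathcal B}$ intersect in four distinct points of $\mathbb P^2(\overline{\mathbb F}_q)$, and let $\Gamma \subseteq \Psi$ be the subset of pairs satisfying the Poncelet triangle condition. Then \[ \frac{q-16}{q\,(q+1)} \;\le\; \frac{|\Gamma|}{|\Psi|} \;\le\; \frac{q+5}{(q-2)(q-3)}. \]
   Context: $\mathbb F_q$ is the field with $q$ elements and $\overline{\mathbb F}_q$ an algebraic closure. A conic in $\mathbb P^2(\mathbb F_q)$ is the zero locus of a nonzero quadratic form in $x,y,z$ with coefficients in $\mathbb F_q$; it is nonsingular if its symmetric $3\times 3$ matrix is invertible. For a conic $\mathcal C$ over $\mathbb F_q$, $\overline{\mathcal C}$ denotes the conic in $\mathbb P^2(\overline{\mathbb F}_q)$ given by the same equation. For nonsingular conics $\mathcal A', \mathcal B'$ in $\mathbb P^2(\overline{\mathbb F}_q)$, an $\mathcal A'\circ\mathcal B'$ triangle is a triple of pairwise distinct points $P_1,P_2,P_3 \in \mathcal A'$ such that the lines $P_1P_2$, $P_2P_3$, $P_3P_1$ are all tangent to $\mathcal B'$. A pair $(\mathcal A,\mathcal B)$ of nonsingular conics in $\mathbb P^2(\mathbb F_q)$ satisfies the Poncelet triangle condition (PTC) if $\overline{\mathcal A}$ and $\overline{\mathcal B}$ intersect in four distinct points and there exists an $\overline{\mathcal A}\circ\overline{\mathcal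 B}$ triangle. *)

(* Defs.v *)
From HB Require Import structures.
From mathcomp Require Import all_boot all_order all_algebra all_field.
Set Implicit Arguments. Unset Strict Implicit. Unset Printing Implicit Defensive.
Import Order.TTheory GRing.Theory Num.Theory.
Local Open Scope ring_scope.

(* A conic over a field K is given by its symmetric 3x3 matrix M; a point of
   P^2(K) is represented by a nonzero row vector v, and v is on the conic iff
   v M v^T = 0. *)
Definition qf (K : fieldType) (M : 'M[K]_3) (v : 'rV[K]_3) : K :=
  (v *m M *m v^T) 0 0.

Definition proj_eq (K : fieldType) (u v : 'rV[K]_3) : Prop :=
  exists c : K, c != 0 /\ u = c *: v.

Definition on_conic (K : fieldType) (M : 'M[K]_3) (v : 'rV[K]_3) : Prop :=
  v != 0 /\ qf M v = 0.

Definition on_line (K : fieldType) (P Q S : 'rV[K]_3) : Prop :=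
  exists a b : K, S = a *: P + b *: Q.

Definition meet_in_four (K : fieldType) (A B : 'M[K]_3) : Prop :=
  exists P : 'I_4 -> 'rV[K]_3,
    (forall i, on_conic A (P i) /\ on_conic B (P i)) /\
    (forall i j, i != j -> ~ proj_eq (P i) (P j)) /\
    (forall S, on_conic A S -> on_conic B S -> exists i, proj_eq S (P i)).

Definition tangent (K : fieldType) (B : 'M[K]_3) (P Q : 'rV[K]_3) : Prop :=
  exists R, on_conic B R /\ on_line P Q R /\
    forall S, on_conic B S -> on_line P Q S -> proj_eq S R.

Definition poncelet_triangle (K : fieldType) (A B : 'M[K]_3) : Prop :=
  exists P1 P2 P3 : 'rV[K]_3,
    [/\ on_conic A P1, on_conic A P2 & on_conic A P3] /\
    [/\ ~ proj_eq P1 P2, ~ proj_eq P2 P3 & ~ proj_eq P3 P1] /\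
    [/\ tangent B P1 P2, tangent B P2 P3 & tangent B P3 P1].

(* Conics over F (forms up to nonzero scalar) are represented by the unique
   normalized symmetric matrix: the first nonzero entry (in enumeration order
   of 'I_3 * 'I_3) equals 1. *)
Definition normalized (F : finFieldType) (M : 'M[F]_3) : bool :=
  if [pick k : 'I_3 * 'I_3 | M k.1 k.2 != 0] is Some k
  then M k.1 k.2 == 1 else false.

Definition conic_rep (F : finFieldType) (M : 'M[F]_3) : bool :=
  (M^T == M) && normalized M.

Definition nonsing_conic (F : finFieldType) (M : 'M[F]_3) : bool :=
  conic_rep M && (\det M != 0).

(* membership in Psi, computed over an algebraic closure L of F via f *)
Definition in_Psi (F : finFieldType) (L : fieldType) (f : {rmorphism F -> L})
    (AB : 'M[F]_3 * 'M[F]_3) : Prop :=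
  [/\ nonsing_conic AB.1, nonsing_conic AB.2 &
      meet_in_four (map_mx f AB.1) (map_mx f AB.2)].

Definition in_Gamma (F : finFieldType) (L : fieldType) (f : {rmorphism F -> L})
    (AB : 'M[F]_3 * 'M[F]_3) : Prop :=
  in_Psi f AB /\ poncelet_triangle (map_mx f AB.1) (map_mx f AB.2).

(* Main.v *)
Require Import Defs.
From HB Require Import structures.
From mathcomp Require Import all_boot all_order all_algebra all_field.
From mathcomp Require Import ring lra.
Set Implicit Arguments. Unset Strict Implicit. Unset Printing Implicit Defensive.
Import Order.TTheory GRing.Theory Num.Theory.
Local Open Scope ring_scope.

(* Write det (t A + B) = det A (t^3 + s1 t^2 + s2 t + s3).  Over the closure, A
   and B meet in four_neq0 distinct points iff this cubic is separable, and then a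
   Poncelet triangle exists iff s2^2 = 4 s1 s3 (Cayley): in the basis formed by
   the vertices of a triangle, A has zero diagonal and B is, up to rescaling,
   2 I - J; conversely pencils with the same separable cubic are congruent, so
   it suffices to match (A, B) with such a model.

   Over F, for each separable cubic c the number of pairs of symmetric matrices
   (A, B) with det A <> 0 and cubic c is #|GL_3(F)|, independently of c: put
   X = B A^-1, pick g conjugating X to the companion matrix C of c, and observe
   that g A g^T = h H with h in the centralizer of C and H a fixed Hankel
   matrix; then (A, B) |-> h g is a bijection.  Hence |Gamma| / |Psi| is a
   quotient of two numbers of cubics, both of which are easily bounded. *)

(** * Explicit 3 x 3 matrices *)

Definition mx3 (R : Type) (a b c d e f g h i : R) : 'M[R]_3 :=
  \matrix_(j, k) nth a (nth [::] [:: [:: a; b; c]; [:: d; e; f]; [:: g; h; i]] j) k.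

Lemma mx3_eta (R : Type) (M : 'M[R]_3) :
  M = mx3 (M 0 0) (M 0 1) (M 0 2) (M 1 0) (M 1 1) (M 1 2)
          (M 2 0) (M 2 1) (M 2 2).
Proof.
apply/matrixP=> -[[|[|[|//]]] ltj] [[|[|[|//]]] ltk]; rewrite mxE /=;
  congr (M _ _); exact: val_inj.
Qed.

Lemma mx3P (R : Type) (P : 'M[R]_3 -> Prop) :
  (forall a b c d e f g h i, P (mx3 a b c d e f g h i)) -> forall M, P M.
Proof. by move=> H M; rewrite [M]mx3_eta. Qed.

Lemma mx3_inj (R : Type) (a b c d e f g h i a' b' c' d' e' f' g' h' i' : R) :
  mx3 a b c d e f g h i = mx3 a' b' c' d' e' f' g' h' i' ->
  (a = a' /\ b = b' /\ c = c') /\ (d = d' /\ e = e' /\ f = f') /\ (g = g' /\ h = h' /\ i = i').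
Proof.
move/matrixP=> E.
have := (E 0 0, E 0 1, E 0 2, E 1 0, E 1 1, E 1 2, E 2 0, E 2 1, E 2 2).
by rewrite !mxE /= => -[[[[[[[[-> ->] ->] ->] ->] ->] ->] ->] ->].
Qed.

Lemma tr_mx3 (R : Type) (a b c d e f g h i : R) :
  (mx3 a b c d e f g h i)^T = mx3 a d g b e h c f i.
Proof. by rewrite [LHS]mx3_eta !mxE. Qed.

Definition row3 (R : Type) (x y z : R) : 'rV[R]_3 :=
  \row_j nth x [:: x; y; z] j.

Lemma row3_eta (R : Type) (v : 'rV[R]_3) : v = row3 (v 0 0) (v 0 1) (v 0 2).
Proof.
apply/rowP=> -[[|[|[|//]]] ltj]; rewrite mxE /=; congr (v _ _); exact: val_inj.
Qed.

Lemma row3P (R : Type) (P : 'rV[R]_3 -> Prop) :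
  (forall x y z, P (row3 x y z)) -> forall v, P v.
Proof. by move=> H v; rewrite [v]row3_eta. Qed.

Section Ring.
Variable R : comNzRingType.
Implicit Types a b c d e f g h i t x y z : R.

Lemma sum3 (F : 'I_3 -> R) : \sum_i F i = F 0 + F 1 + F 2.
Proof.
rewrite 3!big_ord_recl big_ord0 addr0 addrA.
by congr (F _ + F _ + F _); exact: val_inj.
Qed.

Lemma mul_mx3 a b c d e f g h i a' b' c' d' e' f' g' h' i' :
  mx3 a b c d e f g h i *m mx3 a' b' c' d' e' f' g' h' i' =
  mx3 (a * a' + b * d' + c * g') (a * b' + b * e' + c * h') (a * c' + b * f' + c * i')
      (d * a' + e * d' + f * g') (d * b' + e * e' + f * h') (d * c' + e * f' + f * i')
      (g * a' + h * d' + i * g') (g * b' + h * e' + i * h') (g * c' + h * f' + i * i').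
Proof. by rewrite [LHS]mx3_eta !mxE !sum3 !mxE. Qed.

Lemma add_mx3 a b c d e f g h i a' b' c' d' e' f' g' h' i' :
  mx3 a b c d e f g h i + mx3 a' b' c' d' e' f' g' h' i' =
  mx3 (a + a') (b + b') (c + c') (d + d') (e + e') (f + f') (g + g') (h + h') (i + i').
Proof. by rewrite [LHS]mx3_eta !mxE. Qed.

Lemma scale_mx3 x a b c d e f g h i :
  x *: mx3 a b c d e f g h i =
  mx3 (x * a) (x * b) (x * c) (x * d) (x * e) (x * f) (x * g) (x * h) (x * i).
Proof. by rewrite [LHS]mx3_eta !mxE. Qed.

Lemma opp_mx3 a b c d e f g h i :
  - mx3 a b c d e f g h i = mx3 (- a) (- b) (- c) (- d) (- e) (- f) (- g) (- h) (- i).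
Proof. by rewrite [LHS]mx3_eta !mxE. Qed.

Lemma scalar_mx3 (x : R) : x%:M = mx3 x 0 0 0 x 0 0 0 x :> 'M[R]_3.
Proof. by rewrite [LHS]mx3_eta !mxE. Qed.

Lemma det_mx2 (M : 'M[R]_2) : \det M = M 0 0 * M 1 1 - M 0 1 * M 1 0.
Proof.
rewrite (expand_det_row _ 0) 2!big_ord_recl big_ord0 addr0 /cofactor !det_mx11.
rewrite !mxE /= expr0 mul1r expr1 mulN1r mulrN.
by congr (M _ _ * M _ _ - M _ _ * M _ _); exact: val_inj.
Qed.

Lemma det_mx3 a b c d e f g h i :
  \det (mx3 a b c d e f g h i) =
  a * e * i + b * f * g + c * d * h - a * f * h - b * d * i - c * e * g.
Proof.
rewrite (expand_det_row _ 0) sum3 /cofactor !det_mx2 !mxE /=.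
ring.
Qed.

Definition diag3 a b c := mx3 a 0 0 0 b 0 0 0 c.

Lemma det_diag3 a b c : \det (diag3 a b c) = a * b * c.
Proof. by rewrite det_mx3; ring. Qed.

Lemma tr_diag3 a b c : (diag3 a b c)^T = diag3 a b c.
Proof. exact: tr_mx3. Qed.

Lemma mul_diag3 a b c a' b' c' :
  diag3 a b c *m diag3 a' b' c' = diag3 (a * a') (b * b') (c * c').
Proof. by rewrite mul_mx3; congr mx3; ring. Qed.

Lemma mul_row3 x y z a b c d e f g h i :
  row3 x y z *m mx3 a b c d e f g h i =
  row3 (x * a + y * d + z * g) (x * b + y * e + z * h) (x * c + y * f + z * i).
Proof. by rewrite [LHS]row3_eta !mxE !sum3 !mxE. Qed.

Lemma scale_row3 t x y z : t *: row3 x y z = row3 (t * x) (t * y) (t * z).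
Proof. by rewrite [LHS]row3_eta !mxE. Qed.

Lemma add_row3 x y z x' y' z' :
  row3 x y z + row3 x' y' z' = row3 (x + x') (y + y') (z + z').
Proof. by rewrite [LHS]row3_eta !mxE. Qed.

Lemma row3_eq0 x y z : (row3 x y z == 0) = [&& x == 0, y == 0 & z == 0].
Proof.
apply/eqP/and3P=> [/rowP E|[/eqP-> /eqP-> /eqP->]]; last by rewrite [LHS]row3_eta [RHS]row3_eta !mxE.
by have := (E 0, E 1, E 2); rewrite !mxE /= => -[[-> ->] ->].
Qed.

Lemma dot_row3 x y z x' y' z' :
  (row3 x y z *m (row3 x' y' z')^T) 0 0 = x * x' + y * y' + z * z'.
Proof. by rewrite !mxE !sum3 !mxE. Qed.

End Ring.

Lemma qf_row3 (K : fieldType) (a b c d e f g h i x y z : K) :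
  qf (mx3 a b c d e f g h i) (row3 x y z) =
  a * x ^+ 2 + e * y ^+ 2 + i * z ^+ 2
  + (b + d) * (x * y) + (c + g) * (x * z) + (f + h) * (y * z).
Proof. by rewrite /qf mul_row3 dot_row3; ring. Qed.

Lemma row3_inj (R : Type) (x y z x' y' z' : R) :
  row3 x y z = row3 x' y' z' -> x = x' /\ y = y' /\ z = z'.
Proof.
by move/rowP=> E; have := (E 0, E 1, E 2); rewrite !mxE /= => -[[-> ->] ->].
Qed.

Definition mx3E := (tr_mx3, mul_mx3, add_mx3, opp_mx3, scale_mx3, scalar_mx3, det_mx3).

(** * Invariants of a pencil of conics *)

Section Pencil.
Variable K : fieldType.
Implicit Types (A B P X : 'M[K]_3) (t x y : K).

(* For 2 != 0, det (t A + B) = det A (t^3 + s1 t^2 + s2 t + s3); the values at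
   t = 1, -1, 0 determine the coefficients.  Junk when det A = 0. *)
Definition s1 A B := ((\det (A + B) + \det (B - A)) / 2 - \det B) / \det A.
Definition s2 A B := ((\det (A + B) - \det (B - A)) / 2 - \det A) / \det A.
Definition s3 A B := \det B / \det A.

Definition sinv A B := (s1 A B, s2 A B, s3 A B).

(* The discriminant of t^3 + e1 t^2 + e2 t + e3. *)
Definition disc3 (e : K * K * K) :=
  let: (e1, e2, e3) := e in
  e1 ^+ 2 * e2 ^+ 2 - 4 * e2 ^+ 3 - 4 * e1 ^+ 3 * e3 + 18 * e1 * e2 * e3
  - 27 * e3 ^+ 2.

Definition cayley (e : K * K * K) :=
  let: (e1, e2, e3) := e in e2 ^+ 2 == 4 * e1 * e3.

Hypothesis two : 2 != 0 :> K.

Lemma det_pencil2 A B x y : \det A != 0 ->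
  \det (x *: A + y *: B) =
  \det A * (x ^+ 3 + s1 A B * x ^+ 2 * y + s2 A B * x * y ^+ 2 + s3 A B * y ^+ 3).
Proof.
rewrite /s1 /s2 /s3.
move: A; apply: mx3P => a b c d e f g h i; move: B; apply: mx3P => a' b' c' d' e' f' g' h' i'.
set dA := \det (mx3 a _ _ _ _ _ _ _ _) => dA0.
(* Division by [dA] is cleared while [dA] is still opaque; after unfolding, 2 is the only
   denominator left. *)
have clear_dA (c1 c2 c3 : K) :
    dA * (x ^+ 3 + c1 / dA * x ^+ 2 * y + c2 / dA * x * y ^+ 2 + c3 / dA * y ^+ 3) =
    dA * x ^+ 3 + c1 * x ^+ 2 * y + c2 * x * y ^+ 2 + c3 * y ^+ 3.
  by field.
by rewrite clear_dA /dA !mx3E; field; rewrite two.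
Qed.

Lemma sinvP A B e1 e2 e3 : \det A != 0 ->
  (forall t, \det (t *: A + B) = \det A * (t ^+ 3 + e1 * t ^+ 2 + e2 * t + e3)) ->
  sinv A B = (e1, e2, e3).
Proof.
move=> dA0 E; rewrite /sinv /s1 /s2 /s3.
have := (E 1, E (- 1), E 0).
rewrite scale1r scaleN1r scale0r add0r [- A + B]addrC => -[[-> ->] ->].
by congr (_, _, _); field; rewrite ?two ?dA0.
Qed.

Lemma det_pencil A B t : \det A != 0 ->
  \det (t *: A + B) = \det A * (t ^+ 3 + s1 A B * t ^+ 2 + s2 A B * t + s3 A B).
Proof. by move=> dA0; rewrite -[B in LHS]scale1r det_pencil2 // !expr1n !mulr1. Qed.

Lemma det_pencilN A B t : \det A != 0 ->
  \det (B - t *: A) = \det A * (s3 A B - s2 A B * t + s1 A B * t ^+ 2 - t ^+ 3).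
Proof. by move=> dA0; rewrite addrC -scaleNr det_pencil //; ring. Qed.

(** Every member of the pencil has its determinant multiplied by the same factor [(\det P) ^+ 2]. *)
Lemma sinv_congr P A B : \det P != 0 -> \det A != 0 ->
  sinv (P *m A *m P^T) (P *m B *m P^T) = sinv A B.
Proof.
move=> dP0 dA0.
have dPA : \det (P *m A *m P^T) != 0 by rewrite !det_mulmx det_tr !mulf_neq0.
apply: sinvP => // t.
rewrite scalemxAl scalemxAr -mulmxDl -mulmxDr !det_mulmx det_pencil //.
by ring.
Qed.

(** The roots of the cubic are multiplied by [y / x], and [s1], [s2], [s3] have degrees 1, 2, 3 in
    these roots. *)
Lemma sinv_scale x y A B : x != 0 -> \det A != 0 ->
  sinv (x *: A) (y *: B) =
  (y / x * s1 A B, (y / x) ^+ 2 * s2 A B, (y / x) ^+ 3 * s3 A B).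
Proof.
move=> x0 dA0.
have dxA : \det (x *: A) != 0 by rewrite detZ mulf_neq0 // expf_neq0.
apply: sinvP => // t; rewrite scalerA det_pencil2 // detZ.
by field.
Qed.

(** Giving e_i weight i, [disc3] is homogeneous of weight 6 and both sides of [cayley] have weight
    4. Hence both conditions depend on the conics alone, not on the matrices chosen for them. *)
Lemma disc3_scale r e1 e2 e3 :
  disc3 (r * e1, r ^+ 2 * e2, r ^+ 3 * e3) = r ^+ 6 * disc3 (e1, e2, e3).
Proof. by rewrite /disc3; ring. Qed.

Lemma cayley_scale r e1 e2 e3 : r != 0 ->
  cayley (r * e1, r ^+ 2 * e2, r ^+ 3 * e3) = cayley (e1, e2, e3).
Proof.
move=> r0; rewrite /cayley.
have -> : (r ^+ 2 * e2) ^+ 2 = r ^+ 4 * e2 ^+ 2 by ring.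
have -> : 4 * (r * e1) * (r ^+ 3 * e3) = r ^+ 4 * (4 * e1 * e3) by ring.
by rewrite (inj_eq (mulfI (expf_neq0 4 r0))).
Qed.

(** The cubic here is the product of the factors t + l_i. Its roots are the - l_i, and the common
    sign does not affect squared differences. *)
Lemma disc3_roots l0 l1 l2 :
  disc3 (l0 + l1 + l2, l0 * l1 + l1 * l2 + l2 * l0, l0 * l1 * l2) =
  ((l0 - l1) * (l1 - l2) * (l2 - l0)) ^+ 2.
Proof. by rewrite /disc3; ring. Qed.

End Pencil.

Lemma sinv_map (K L : fieldType) (f : {rmorphism K -> L}) (A B : 'M[K]_3) :
  sinv (map_mx f A) (map_mx f B) = (f (s1 A B), f (s2 A B), f (s3 A B)).
Proof.
rewrite /sinv /s1 /s2 /s3 -map_mxD -map_mxB !det_map_mx !fmorph_div /=.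
by rewrite !rmorphB !fmorph_div !rmorph_nat !(rmorphB, rmorphD).
Qed.

Lemma disc3_map (K L : fieldType) (f : {rmorphism K -> L}) e1 e2 e3 :
  disc3 (f e1, f e2, f e3) = f (disc3 (e1, e2, e3)).
Proof. by rewrite /disc3; ring. Qed.

Lemma cayley_map (K L : fieldType) (f : {rmorphism K -> L}) e1 e2 e3 :
  cayley (f e1, f e2, f e3) = cayley (e1, e2, e3).
Proof.
rewrite /cayley -!rmorphXn /= -[4 : L](rmorph_nat f) -!rmorphM /=.
by rewrite (inj_eq (fmorph_inj f)).
Qed.

(** Take a root [l0] of t^3 - e1 t^2 + e2 t - e3, then a root [l1] of the quadratic quotient; the
    third root is forced by the sum. The coefficient lists are those of the lower terms moved to the
    right-hand side. *)
Lemma cubic_roots (L : closedFieldType) (e1 e2 e3 : L) :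
  exists l0 l1 l2, [/\ e1 = l0 + l1 + l2, e2 = l0 * l1 + l1 * l2 + l2 * l0
                     & e3 = l0 * l1 * l2].
Proof.
have [l0] := @solve_monicpoly L 3 (nth 0 [:: e3; - e2; e1]) isT.
have [l1] := @solve_monicpoly L 2 (nth 0 [:: - (e2 - l0 * (e1 - l0)); e1 - l0]) isT.
rewrite !big_ord_recl !big_ord0 /= !addr0 !expr0 !mulr1 !expr1 => E2 E3.
exists l0, l1, (e1 - l0 - l1).
have Eq : l1 * (e1 - l0 - l1) = e2 - l0 * (e1 - l0).
  by rewrite -[LHS]opprK -[RHS]opprK -[- (e2 - _)](addrK ((e1 - l0) * l1)) -E2; ring.
split; first by ring.
  by rewrite Eq; ring.
rewrite -mulrA Eq -[e3](addrK (- e2 * l0 + e1 * l0 ^+ 2)) -E3.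
by ring.
Qed.

(** * Matrices given by their rows, Gram matrices and independence of eigenvectors *)

Definition rows3 (R : Type) (u v w : 'rV[R]_3) : 'M[R]_3 :=
  \matrix_(i, j) (nth u [:: u; v; w] i) 0 j.

Lemma rows3_row3 (R : Type) (a b c d e f g h i : R) :
  rows3 (row3 a b c) (row3 d e f) (row3 g h i) = mx3 a b c d e f g h i.
Proof. by rewrite [LHS]mx3_eta !mxE. Qed.

Section Rows.
Variable R : comNzRingType.
Implicit Types (u v w : 'rV[R]_3) (M : 'M[R]_3).

Lemma rows3_mul u v w M : rows3 u v w *m M = rows3 (u *m M) (v *m M) (w *m M).
Proof.
apply/matrixP=> -[[|[|[|//]]] lti] j; rewrite !mxE /=;
  by apply: eq_bigr => k _; rewrite !mxE.
Qed.

Lemma mul_rows3 (a b c : R) u v w :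
  row3 a b c *m rows3 u v w = a *: u + b *: v + c *: w.
Proof. by rewrite [LHS]row3_eta [RHS]row3_eta !mxE !sum3 !mxE /=. Qed.

Lemma gram_rows3 u v w u' v' w' :
  rows3 u v w *m (rows3 u' v' w')^T =
  mx3 ((u *m u'^T) 0 0) ((u *m v'^T) 0 0) ((u *m w'^T) 0 0)
      ((v *m u'^T) 0 0) ((v *m v'^T) 0 0) ((v *m w'^T) 0 0)
      ((w *m u'^T) 0 0) ((w *m v'^T) 0 0) ((w *m w'^T) 0 0).
Proof. by rewrite [LHS]mx3_eta !mxE !sum3 !mxE. Qed.

Lemma bil_sym M u v : M^T = M -> (u *m M *m v^T) 0 0 = (v *m M *m u^T) 0 0.
Proof.
move=> sM; have -> : v *m M *m u^T = (u *m M *m v^T)^T.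
  by rewrite !trmx_mul trmxK sM mulmxA.
by rewrite [RHS]mxE.
Qed.

End Rows.

Lemma rows3_dep (K : idomainType) (u v w : 'rV[K]_3) :
  \det (rows3 u v w) = 0 ->
  exists a b c, ~~ [&& a == 0, b == 0 & c == 0] /\ a *: u + b *: v + c *: w = 0.
Proof.
move/eqP/det0P=> [x]; move: x; apply: row3P => a b c; rewrite row3_eq0 mul_rows3.
by exists a, b, c.
Qed.

Lemma sqrt_closed (L : closedFieldType) (x : L) : exists s, s ^+ 2 = x.
Proof.
have [s] := @solve_monicpoly L 2 (nth 0 [:: x; 0]) isT.
by rewrite !big_ord_recl big_ord0 /= mul0r !addr0 mulr1; exists s.
Qed.

(** Applying a polynomial in [X] of degree at most 2 to a linear relation multiplies each
    coefficient by the value of the polynomial at the matching eigenvalue; this is [comb] below. *)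
Lemma eigen_indep (K : fieldType) (Q X : 'M[K]_3) (u v w : 'rV[K]_3) (l0 l1 l2 : K) :
  u != 0 -> v != 0 -> w != 0 ->
  u *m X = l0 *: u -> v *m X = l1 *: v -> w *m X = l2 *: w ->
  (l0 - l1) * (l1 - l2) * (l2 - l0) != 0 -> \det (rows3 u v w) != 0.
Proof.
move=> u0 v0 w0 uX vX wX; rewrite !mulf_eq0 !negb_or => /andP[/andP[l01 l12] l20].
apply/eqP=> /rows3_dep[a [b [c [nz E0]]]].
have step a' b' c' : a' *: u + b' *: v + c' *: w = 0 ->
  (a' * l0) *: u + (b' * l1) *: v + (c' * l2) *: w = 0.
  by move/(congr1 (mulmx^~ X)); rewrite !mulmxDl -!scalemxAl mul0mx uX vX wX !scalerA.
have E1 := step _ _ _ E0; have E2 := step _ _ _ E1.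
have comb (x y z : K) : (a * (x + l0 * y + l0 ^+ 2 * z)) *: u + (b * (x + l1 * y + l1 ^+ 2 * z)) *: v
   + (c * (x + l2 * y + l2 ^+ 2 * z)) *: w = 0.
  have -> : 0 = x *: (a *: u + b *: v + c *: w) +
      y *: ((a * l0) *: u + (b * l1) *: v + (c * l2) *: w)
     + z *: ((a * l0 * l0) *: u + (b * l1 * l1) *: v + (c * l2 * l2) *: w).
    by rewrite E0 E1 E2 !scaler0 !addr0.
  by apply/rowP=> j; rewrite !mxE; ring.
have kill (t x : K) : t != 0 -> x * t = 0 -> x == 0.
  by move=> t0 /eqP; rewrite mulf_eq0 (negPf t0) orbF.
case/negP: nz; apply/and3P; split.
(* The polynomial (t - l1) (t - l2) annihilates the terms in [v] and [w], leaving [u] alone. The two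
   other cases are analogous. *)
- have /eqP := comb (l1 * l2) (- (l1 + l2)) 1.
  have -> : l0 ^+ 2 = l0 * l0 by []; have -> : l1 * l2 + l1 * - (l1 + l2) + l1 ^+ 2 * 1 = 0 by ring.
  have -> : l1 * l2 + l2 * - (l1 + l2) + l2 ^+ 2 * 1 = 0 by ring.
  rewrite !mulr0 !scale0r !addr0 scaler_eq0 (negPf u0) orbF => /eqP E.
  apply: (kill ((l0 - l1) * (l2 - l0))); first by rewrite mulf_neq0.
  by rewrite -[RHS]oppr0 -E; ring.
- have /eqP := comb (l0 * l2) (- (l0 + l2)) 1.
  have -> : l0 * l2 + l0 * - (l0 + l2) + l0 ^+ 2 * 1 = 0 by ring.
  have -> : l0 * l2 + l2 * - (l0 + l2) + l2 ^+ 2 * 1 = 0 by ring.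
  rewrite !mulr0 !scale0r add0r !addr0 scaler_eq0 (negPf v0) orbF => /eqP E.
  apply: (kill ((l0 - l1) * (l1 - l2))); first by rewrite mulf_neq0.
  by rewrite -[RHS]oppr0 -E; ring.
- have /eqP := comb (l0 * l1) (- (l0 + l1)) 1.
  have -> : l0 * l1 + l0 * - (l0 + l1) + l0 ^+ 2 * 1 = 0 by ring.
  have -> : l0 * l1 + l1 * - (l0 + l1) + l1 ^+ 2 * 1 = 0 by ring.
  rewrite !mulr0 !scale0r !add0r scaler_eq0 (negPf w0) orbF => /eqP E.
  apply: (kill ((l1 - l2) * (l2 - l0))); first by rewrite mulf_neq0.
  by rewrite -[RHS]oppr0 -E; ring.
Qed.

(** * Simultaneous diagonalization *)

Section Closed.
Variable L : closedFieldType.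
Hypothesis two : 2 != 0 :> L.
Implicit Types (A B P : 'M[L]_3).

(** Eigenvectors of [B] relative to [A] for distinct eigenvalues are orthogonal for both forms.
    Scaling each by a square root of the inverse of its [A]-value turns [A] into the identity. *)
Lemma simdiag A B l0 l1 l2 :
  A^T = A -> B^T = B -> \det A != 0 ->
  sinv A B = (l0 + l1 + l2, l0 * l1 + l1 * l2 + l2 * l0, l0 * l1 * l2) ->
  (l0 - l1) * (l1 - l2) * (l2 - l0) != 0 ->
  exists P, [/\ \det P != 0, P *m A *m P^T = 1%:M &
               P *m B *m P^T = diag3 l0 l1 l2].
Proof.
move=> sA sB dA [E1 E2 E3] dist.
(* The determinant of [B - l *: A] is - det A (l - l0) (l - l1) (l - l2). *)
have eig l : (l - l0) * (l - l1) * (l - l2) = 0 ->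
    exists2 v : 'rV[L]_3, v != 0 & v *m B = l *: (v *m A).
  move=> rl; have : \det (B - l *: A) == 0.
    rewrite det_pencilN // E1 E2 E3 -[eqbRHS](mulr0 (- \det A)) -rl.
    by apply/eqP; ring.
  case/det0P=> v v0 /eqP; rewrite mulmxBr subr_eq0 => /eqP E; exists v => //.
  by rewrite E -scalemxAr.
have [u u0 uB] : exists2 v : 'rV[L]_3, v != 0 & v *m B = l0 *: (v *m A).
  by apply: eig; ring.
have [v v0 vB] : exists2 v : 'rV[L]_3, v != 0 & v *m B = l1 *: (v *m A).
  by apply: eig; ring.
have [w w0 wB] : exists2 v : 'rV[L]_3, v != 0 & v *m B = l2 *: (v *m A).
  by apply: eig; ring.
have uA : A \in unitmx by rewrite unitmxE unitfE.
have dQ : \det (rows3 u v w) != 0.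
  apply: (@eigen_indep _ 0 (B *m invmx A) _ _ _ l0 l1 l2) => //.
  - by rewrite mulmxA uB -scalemxAl mulmxK.
  - by rewrite mulmxA vB -scalemxAl mulmxK.
  - by rewrite mulmxA wB -scalemxAl mulmxK.
(* Evaluating x B y^T from either side, by symmetry, gives both [l] and [m] times x A y^T. *)
have orth (x y : 'rV[L]_3) (l m : L) : x *m B = l *: (x *m A) -> y *m B = m *: (y *m A) -> l - m != 0 ->
    (x *m A *m y^T) 0 0 = 0.
  move=> xB yB lm; apply/eqP; rewrite -[_ == 0]orFb -(negPf lm) -mulf_eq0 mulrBl.
  have -> : l * (x *m A *m y^T) 0 0 = (x *m B *m y^T) 0 0.
    by rewrite xB -scalemxAl [RHS]mxE.
  have -> : m * (x *m A *m y^T) 0 0 = (x *m B *m y^T) 0 0.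
    by rewrite (bil_sym _ _ sB) (bil_sym _ _ sA) yB -scalemxAl [RHS]mxE.
  by rewrite subrr.
move: (dist); rewrite !mulf_eq0 !negb_or => /andP[/andP[d01 d12] d20].
have opp x y : x - y != 0 -> y - x != 0 :> L by rewrite -opprB oppr_eq0.
set Q := rows3 u v w in dQ.
have QA : Q *m A *m Q^T = diag3 ((u *m A *m u^T) 0 0) ((v *m A *m v^T) 0 0)
                                ((w *m A *m w^T) 0 0).
  rewrite rows3_mul gram_rows3.
  by rewrite (orth u v l0 l1) ?(orth u w l0 l2) ?(orth v u l1 l0) ?(orth v w l1 l2)
    ?(orth w u l2 l0) ?(orth w v l2 l1) // opp.
have QB : Q *m B = diag3 l0 l1 l2 *m (Q *m A).
  rewrite !rows3_mul uB vB wB -[diag3 _ _ _]rows3_row3 rows3_mul !mul_rows3.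
  by rewrite !scale0r !addr0 !add0r.
(* The Gram matrix of [A] is diagonal and invertible, so none of the three eigenvectors is
   isotropic. *)
have : \det (Q *m A *m Q^T) != 0 by rewrite !det_mulmx det_tr !mulf_neq0.
rewrite QA det_diag3.
move: QA; set a := (_ *m _) 0 0; set b := (_ *m _) 0 0; set c := (_ *m _) 0 0.
clearbody a b c => QA.
rewrite !mulf_eq0 !negb_or => /andP[/andP[a0 b0] c0].
have [x xE] := sqrt_closed a^-1; have [y yE] := sqrt_closed b^-1.
have [z zE] := sqrt_closed c^-1.
set S := diag3 x y z.
have nz s t : s ^+ 2 = t^-1 -> t != 0 -> s != 0 :> L.
  by move=> E t0; rewrite -sqrf_eq0 E invr_eq0.
exists (S *m Q); split.
- rewrite det_mulmx mulf_neq0 // det_diag3.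
  by rewrite (mulf_neq0 (mulf_neq0 (nz _ _ xE a0) (nz _ _ yE b0)) (nz _ _ zE c0)).
- have -> : S *m Q *m A *m (S *m Q)^T = S *m (Q *m A *m Q^T) *m S^T.
    by rewrite trmx_mul !mulmxA.
  have e (s t : L) : s ^+ 2 = t^-1 -> t != 0 -> s * t * s = 1.
    by move=> Es t0; rewrite -(mulVf t0) -Es; ring.
  by rewrite QA tr_diag3 !mul_diag3 (e _ _ xE) // (e _ _ yE) // (e _ _ zE) // scalar_mx3.
- have -> : S *m Q *m B *m (S *m Q)^T = S *m (Q *m B) *m Q^T *m S^T.
    by rewrite trmx_mul !mulmxA.
  rewrite QB; have -> : S *m (diag3 l0 l1 l2 *m (Q *m A)) *m Q^T *m S^T =
      S *m diag3 l0 l1 l2 *m (Q *m A *m Q^T) *m S^T by rewrite !mulmxA.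
  rewrite QA tr_diag3 !mul_diag3.
  have e (s t l : L) : s ^+ 2 = t^-1 -> t != 0 -> s * l * t * s = l.
    by move=> Es t0; rewrite -[RHS]mulr1 -(mulVf t0) -Es; ring.
  by rewrite (e _ _ _ xE) // (e _ _ _ yE) // (e _ _ _ zE).
Qed.

(** Both pairs are congruent to the same diagonal normal form, read off from the roots of their
    common cubic. *)
Lemma pencil_congr A B A' B' :
  A^T = A -> B^T = B -> A'^T = A' -> B'^T = B' -> \det A != 0 -> \det A' != 0 ->
  sinv A B = sinv A' B' -> disc3 (sinv A B) != 0 ->
  exists M, [/\ \det M != 0, M *m A *m M^T = A' & M *m B *m M^T = B'].
Proof.
move=> sA sB sA' sB' dA dA' Es.
have [l0 [l1 [l2 [E1 E2 E3]]]] := cubic_roots (s1 A B) (s2 A B) (s3 A B).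
have E : sinv A B = (l0 + l1 + l2, l0 * l1 + l1 * l2 + l2 * l0, l0 * l1 * l2).
  by rewrite /sinv E1 E2 E3.
rewrite E disc3_roots sqrf_eq0 => dist.
have [P [dP PA PB]] := simdiag sA sB dA E dist.
have [P' [dP' PA' PB']] := simdiag sA' sB' dA' (etrans (esym Es) E) dist.
have uP' : P' \in unitmx by rewrite unitmxE unitfE.
have tr C D : P *m C *m P^T = P' *m D *m P'^T ->
    invmx P' *m P *m C *m (invmx P' *m P)^T = D.
  move=> CD; rewrite trmx_mul.
  have -> : invmx P' *m P *m C *m (P^T *m (invmx P')^T) =
     invmx P' *m (P *m C *m P^T) *m (invmx P')^T by rewrite !mulmxA.
  by rewrite CD -!mulmxA -trmx_mul mulVmx // trmx1 mulmx1 mulKmx.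
exists (invmx P' *m P); split.
- by rewrite det_mulmx mulf_neq0 // det_inv invr_eq0.
- by apply: tr; rewrite PA PA'.
- by apply: tr; rewrite PB PB'.
Qed.

End Closed.

(** * Transversality and the Poncelet condition *)

Section Transfer.
Variable K : fieldType.
Implicit Types (A B M : 'M[K]_3) (u v P Q S : 'rV[K]_3).

Lemma qf_congr M A v : qf (M *m A *m M^T) v = qf A (v *m M).
Proof. by rewrite /qf trmx_mul !mulmxA. Qed.

Variable M : 'M[K]_3.
Hypothesis dM : \det M != 0.
Let uM : M \in unitmx. Proof. by rewrite unitmxE unitfE. Qed.

Lemma on_conic_congr A v : on_conic (M *m A *m M^T) v <-> on_conic A (v *m M).
Proof.
rewrite /on_conic qf_congr; suff -> : (v *m M != 0) = (v != 0) by [].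
congr (~~ _); apply/eqP/eqP=> [E|->]; last exact: mul0mx.
by rewrite -[v](mulmxK uM) E mul0mx.
Qed.

Lemma proj_eq_mul u v : proj_eq (u *m M) (v *m M) <-> proj_eq u v.
Proof.
split=> -[c [c0 E]]; exists c; split=> //; last by rewrite E scalemxAl.
by rewrite -[u](mulmxK uM) E -scalemxAl mulmxK.
Qed.

Lemma on_line_mul P Q S : on_line (P *m M) (Q *m M) (S *m M) <-> on_line P Q S.
Proof.
split=> -[x [y E]]; exists x, y; last by rewrite E mulmxDl !scalemxAl.
by rewrite -[S](mulmxK uM) E mulmxDl -!scalemxAl !mulmxK.
Qed.

(** The coordinate change [v |-> v *m M] carries the conic of M A M^T onto that of [A] and respects
    points and lines, so properties established for a normal form pass to the original pair. *)
Lemma meet_in_four_congr A B :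
  meet_in_four (M *m A *m M^T) (M *m B *m M^T) -> meet_in_four A B.
Proof.
move=> [P [onP [neqP allP]]]; exists (fun i => P i *m M); split; last split.
- by move=> i; have [/on_conic_congr ? /on_conic_congr ?] := onP i.
- by move=> i j /neqP nij /proj_eq_mul.
- move=> S; rewrite -[S](mulmxKV uM) => /on_conic_congr SA /on_conic_congr SB.
  by have [i Ei] := allP _ SA SB; exists i; apply/proj_eq_mul.
Qed.

Lemma tangent_congr B P Q :
  tangent (M *m B *m M^T) P Q -> tangent B (P *m M) (Q *m M).
Proof.
move=> [R [onR [lR uR]]]; exists (R *m M); split; first exact/on_conic_congr.
split; first exact/on_line_mul.
move=> S; rewrite -[S](mulmxKV uM) => /on_conic_congr SB /on_line_mul lS.
exact/proj_eq_mul/uR.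
Qed.

Lemma poncelet_congr A B :
  poncelet_triangle (M *m A *m M^T) (M *m B *m M^T) -> poncelet_triangle A B.
Proof.
move=> [P1 [P2 [P3 [[o1 o2 o3] [[n1 n2 n3] [t1 t2 t3]]]]]].
exists (P1 *m M), (P2 *m M), (P3 *m M); split; last split.
- by split; apply/on_conic_congr.
- by split=> /proj_eq_mul.
- by split; apply: tangent_congr.
Qed.

End Transfer.

(** * Points of a nonsingular conic *)

Section Points.
Variable K : fieldType.
Hypothesis two : 2 != 0 :> K.
Implicit Types (A B : 'M[K]_3) (u v P Q S : 'rV[K]_3).

Lemma qfZ A c v : qf A (c *: v) = c ^+ 2 * qf A v.
Proof. by rewrite /qf !linearZ /= -!scalemxAl !mxE mulrA. Qed.

(** This is the restriction of the form to the line through [u] and [v], as a binary quadratic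
    form. *)
Lemma qfD A u v x y : A^T = A ->
  qf A (x *: u + y *: v) =
  x ^+ 2 * qf A u + 2 * x * y * (u *m A *m v^T) 0 0 + y ^+ 2 * qf A v.
Proof.
move=> sA; rewrite /qf linearD /= !linearZ /= !mulmxDl !mulmxDr -!scalemxAl -!scalemxAr.
rewrite ![(_ + _ : 'M_(_, _)) 0 0]mxE ![(_ *: (_ : 'M_(_, _))) 0 0]mxE (bil_sym v u sA).
by ring.
Qed.

Lemma proj_eq_sym u v : proj_eq u v -> proj_eq v u.
Proof.
move=> [c [c0 ->]]; exists c^-1; rewrite invr_eq0; split=> //.
by rewrite scalerA mulVf // scale1r.
Qed.

Lemma proj_eq_trans v u w : proj_eq u v -> proj_eq v w -> proj_eq u w.
Proof.
move=> [c [c0 ->]] [d [d0 ->]]; exists (c * d); rewrite mulf_neq0 //.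
by rewrite scalerA.
Qed.

Lemma proj_indep u v x y : u != 0 -> v != 0 -> ~ proj_eq u v ->
  x *: u + y *: v = 0 -> x = 0 /\ y = 0.
Proof.
move=> u0 v0 nuv E; have [x0|x0] := eqVneq x 0.
  move: E; rewrite x0 scale0r add0r => /eqP.
  by rewrite scaler_eq0 (negPf v0) orbF => /eqP.
have [y0|y0] := eqVneq y 0.
  move: E; rewrite y0 scale0r addr0 => /eqP.
  by rewrite scaler_eq0 (negPf u0) orbF => /eqP.
case: nuv; exists (- (y / x)); rewrite oppr_eq0 mulf_neq0 ?invr_eq0 //; split=> //.
apply: (scalerI x0); rewrite scalerA mulrN mulrCA divff // mulr1 scaleNr.
by apply/eqP; rewrite -addr_eq0 E.
Qed.

Lemma no_isotropic_line A u v : A^T = A -> \det A != 0 ->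
  u != 0 -> v != 0 -> ~ proj_eq u v -> qf A u = 0 -> qf A v = 0 ->
  (u *m A *m v^T) 0 0 != 0.
Proof.
move=> sA dA u0 v0 nuv qu qv; apply/eqP=> quv.
(* N A N^T = 0 with N of rank 2 and A invertible would give 2 + 2 <= 3. *)
pose N := col_mx u v.
have rN : \rank N = 2.
  apply/eqP; rewrite -[_ == _]/(row_free N) -kermx_eq0.
  apply/eqP/row_matrixP=> i; rewrite row0.
  have : row i (kermx N) *m N = 0 by apply/sub_kermxP; rewrite row_sub.
  rewrite -[row i _]hsubmxK mul_row_col [lsubmx _]mx11_scalar [rsubmx _]mx11_scalar.
  rewrite !mul_scalar_mx => /(proj_indep u0 v0 nuv)[-> ->].
  by rewrite !raddf0 row_mx0.
have uA : A \in unitmx by rewrite unitmxE unitfE.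
have NAN : N *m A *m N^T = 0.
  rewrite /N mul_col_mx tr_col_mx mul_col_row.
  have z (x y : 'rV[K]_3) : (x *m A *m y^T) 0 0 = 0 -> x *m A *m y^T = 0.
    by move=> E; rewrite [LHS]mx11_scalar E raddf0.
  have qvu : (v *m A *m u^T) 0 0 = 0 by rewrite (bil_sym _ _ sA).
  by rewrite (z u u qu) (z u v quv) (z v u qvu) (z v v qv) block_mx0.
by have := mulmx0_rank_max NAN; rewrite mxrank_tr mxrankMfree ?row_free_unit // rN.
Qed.

(** A line meets a nonsingular conic in at most two points: if a u + b v is proportional to [w],
    then [qfD] gives 2 a b (u A v^T) = 0. The last factor is nonzero, so [a] or [b] vanishes and two
    of the points agree. *)
Lemma conic_points_indep A u v w : A^T = A -> \det A != 0 ->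
  on_conic A u -> on_conic A v -> on_conic A w ->
  ~ proj_eq u v -> ~ proj_eq v w -> ~ proj_eq w u -> \det (rows3 u v w) != 0.
Proof.
move=> sA dA [u0 qu] [v0 qv] [w0 qw] nuv nvw nwu.
apply/eqP=> /rows3_dep[a [b [c [nz E]]]].
have := qfD u v a b sA; rewrite qu qv !mulr0 addr0 add0r.
have -> : a *: u + b *: v = - c *: w.
  by apply/eqP; rewrite scaleNr -addr_eq0 E.
rewrite qfZ qw mulr0 => /esym/eqP; rewrite mulf_eq0.
rewrite (negPf (no_isotropic_line sA dA u0 v0 nuv qu qv)) orbF !mulf_eq0 (negPf two) /=.
case/orP=> /eqP z; move: E nz; rewrite z eqxx /= scale0r ?addr0 ?add0r.
  by move/(proj_indep v0 w0 nvw)=> [-> ->]; rewrite eqxx.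
have nuw : ~ proj_eq u w by move/proj_eq_sym.
by move/(proj_indep u0 w0 nuw)=> [-> ->]; rewrite eqxx.
Qed.

End Points.

(** * Conics through the coordinate points, and transversality from a separable cubic *)

Definition off3 (R : nzRingType) (a b c : R) : 'M[R]_3 := mx3 0 c b c 0 a b a 0.

Section Transversal.
Variable L : closedFieldType.
Hypothesis two : 2 != 0 :> L.
Implicit Types (A B : 'M[L]_3) (u v P Q S : 'rV[L]_3).

Lemma neq_opp (x : L) : x != 0 -> x <> - x.
Proof.
move=> x0 /eqP; rewrite -subr_eq0 opprK -mulr2n -mulr_natl mulf_eq0.
by rewrite (negPf two) (negPf x0).
Qed.

(** In diagonal form the two equations say that x^2 : y^2 : z^2 = (l1 - l2) : (l2 - l0) : (l0 - l1).
    These entries are nonzero, so the solutions differ by signs, and two independent signs remain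
    projectively. *)
Lemma disc_meet_in_four A B : A^T = A -> B^T = B -> \det A != 0 ->
  disc3 (sinv A B) != 0 -> meet_in_four A B.
Proof.
move=> sA sB dA.
have [l0 [l1 [l2 [E1 E2 E3]]]] := cubic_roots (s1 A B) (s2 A B) (s3 A B).
have E : sinv A B = (l0 + l1 + l2, l0 * l1 + l1 * l2 + l2 * l0, l0 * l1 * l2).
  by rewrite /sinv E1 E2 E3.
rewrite E disc3_roots sqrf_eq0 => dist.
have [P [dP PA PB]] := simdiag two sA sB dA E dist.
apply: (meet_in_four_congr dP); rewrite PA PB scalar_mx3.
move: dist; rewrite !mulf_eq0 !negb_or => /andP[/andP[d01 d12] d20].
have [r0 e0] := sqrt_closed (l1 - l2); have [r1 e1] := sqrt_closed (l2 - l0).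
have [r2 e2] := sqrt_closed (l0 - l1).
have r00 : r0 != 0 by rewrite -sqrf_eq0 e0.
have r10 : r1 != 0 by rewrite -sqrf_eq0 e1.
have r20 : r2 != 0 by rewrite -sqrf_eq0 e2.
(* The last coordinate is fixed to [r2]; the signs of the other two are ++, -+, +-, --, in this
   order. *)
pose pt (i : 'I_4) := row3 (nth 0 [:: r0; - r0; r0; - r0] i)
  (nth 0 [:: r1; r1; - r1; - r1] i) r2.
have ptsq (i : 'I_4) : nth 0 [:: r0; - r0; r0; - r0] i ^+ 2 = l1 - l2 /\
    nth 0 [:: r1; r1; - r1; - r1] i ^+ 2 = l2 - l0.
  by case: i => -[|[|[|[|//]]]] ? /=; rewrite ?sqrrN.
exists pt; split; last split.
- move=> i; have [x2 y2] := ptsq i.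
  rewrite /on_conic !qf_row3 !row3_eq0 (negPf r20) !andbF x2 y2 e2.
  by do !split; ring.
- move=> i j nij [c [_ ]]; rewrite scale_row3 => Ep; have [Ex [Ey /eqP]] := row3_inj Ep.
  rewrite -[eqbLHS]mul1r (inj_eq (mulIf r20)) => /eqP c1.
  move: Ex Ey; rewrite -c1 !mul1r {Ep}.
  have nx := neq_opp r00; have ny := neq_opp r10.
  move: i j nij => [[|[|[|[|//]]]] ?] [[|[|[|[|//]]]] ?] //= _ ex ey;
    by [apply: nx | apply: nx; rewrite -{1}ex | apply: ny | apply: ny; rewrite -{1}ey].
- apply: row3P => x y z [S0]; rewrite !qf_row3 => SA [_ SB].
  have {}SA : x ^+ 2 + y ^+ 2 + z ^+ 2 = 0 by rewrite -SA; ring.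
  have {}SB : l0 * x ^+ 2 + l1 * y ^+ 2 + l2 * z ^+ 2 = 0 by move: SB; rewrite qf_row3 => <-; ring.
  have Ex : (r2 * x) ^+ 2 = (z * r0) ^+ 2.
    rewrite !exprMn e0 e2; apply/eqP; rewrite -subr_eq0.
    have -> : (l0 - l1) * x ^+ 2 - z ^+ 2 * (l1 - l2) =
      l0 * x ^+ 2 + l1 * y ^+ 2 + l2 * z ^+ 2 - l1 * (x ^+ 2 + y ^+ 2 + z ^+ 2) by ring.
    by rewrite SA SB mulr0 subrr.
  have Ey : (r2 * y) ^+ 2 = (z * r1) ^+ 2.
    rewrite !exprMn e1 e2; apply/eqP; rewrite -subr_eq0.
    have -> : (l0 - l1) * y ^+ 2 - z ^+ 2 * (l2 - l0) =
      l0 * (x ^+ 2 + y ^+ 2 + z ^+ 2) - (l0 * x ^+ 2 + l1 * y ^+ 2 + l2 * z ^+ 2) by ring.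
    by rewrite SA SB mulr0 subrr.
  (* If [z] were 0, the relations [Ex] and [Ey] would make the whole vector vanish. *)
  have z0 : z != 0.
    have sq0 t r : (r2 * t) ^+ 2 = (z * r) ^+ 2 -> z = 0 -> t = 0.
      move=> Et z0; move: Et; rewrite z0 mul0r => /eqP.
      by rewrite expr0n /= sqrf_eq0 mulf_eq0 (negPf r20) => /eqP.
    apply: contra_neq S0 => z0; apply/eqP.
    by rewrite row3_eq0 (sq0 _ _ Ex z0) (sq0 _ _ Ey z0) z0 eqxx.
  have key (i : 'I_4) : r2 * x = z * nth 0 [:: r0; - r0; r0; - r0] i ->
      r2 * y = z * nth 0 [:: r1; r1; - r1; - r1] i ->
      proj_eq (row3 x y z) (pt i).
    move=> kx ky; exists (z / r2); rewrite mulf_neq0 ?invr_eq0 //; split=> //.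
    rewrite scale_row3 -![z / r2 * _]mulrA ![r2^-1 * _]mulrC !mulrA -kx -ky.
    by rewrite !mulfK // ![r2 * _]mulrC !mulfK.
  move/eqP: Ex; rewrite eqf_sqr => /orP[]/eqP ex;
    move/eqP: Ey; rewrite eqf_sqr => /orP[]/eqP ey.
  + by exists 0; apply: key.
  + by exists 2; apply: key; rewrite ?mulrN.
  + by exists 1; apply: key; rewrite ?mulrN.
  + by exists 3; apply: key; rewrite ?mulrN.
Qed.

Lemma det_off3 (a b c : L) : \det (off3 a b c) = 2 * a * b * c.
Proof. by rewrite det_mx3; ring. Qed.

(** The determinant of t [off3 a b c] + [off3 a' b' c'] factors as 2 (t a + a') (t b + b') (t c +
    c'), so the three ratios play the role of the l_i. *)
Lemma sinv_off3 (a b c a' b' c' : L) : a != 0 -> b != 0 -> c != 0 ->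
  sinv (off3 a b c) (off3 a' b' c') =
  (a' / a + b' / b + c' / c,
   (a' / a) * (b' / b) + (b' / b) * (c' / c) + (c' / c) * (a' / a),
   (a' / a) * (b' / b) * (c' / c)).
Proof.
move=> a0 b0 c0; apply: sinvP => //; first by rewrite det_off3 !mulf_neq0.
move=> t; rewrite /off3 !mx3E; field.
by rewrite a0 b0 c0.
Qed.

Lemma qf_off3 (a b c x y z : L) :
  qf (off3 a b c) (row3 x y z) = 2 * (a * (y * z) + b * (x * z) + c * (x * y)).
Proof. by rewrite qf_row3; ring. Qed.

(** With three points of the conic as basis, the diagonal entries are the values of the form at
    these points. This is applied to common points of two conics and to the vertices of a
    triangle. *)
Lemma gram_off3 A u v w : A^T = A -> on_conic A u -> on_conic A v -> on_conic A w ->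
  exists a b c, rows3 u v w *m A *m (rows3 u v w)^T = off3 a b c.
Proof.
move=> sA [_ qu] [_ qv] [_ qw].
exists ((v *m A *m w^T) 0 0), ((u *m A *m w^T) 0 0), ((u *m A *m v^T) 0 0).
rewrite rows3_mul gram_rows3 (bil_sym v u sA) (bil_sym w u sA) (bil_sym w v sA).
by rewrite -/(qf A u) -/(qf A v) -/(qf A w) qu qv qw.
Qed.
End Transversal.

(** * Four common points force a separable cubic *)

Section MeetInFour.
Variable L : closedFieldType.
Hypothesis two : 2 != 0 :> L.
Implicit Types (A B : 'M[L]_3) (u v P Q S : 'rV[L]_3).

(** The lines through the third coordinate point parametrize the conic by s = X / Y. An
    algebraically closed field is infinite, so [s] can avoid 0, - a / b and x / y. *)
Lemma off3_extra_point (a b c x y : L) : a != 0 -> b != 0 -> c != 0 -> y != 0 ->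
  exists X Y Z, [/\ qf (off3 a b c) (row3 X Y Z) = 0, X != 0, Y != 0 & X * y != x * Y].
Proof.
move=> a0 b0 c0 y0.
have /closed_nonrootP[s] : 'X * ('X - (- a / b)%:P) * ('X - (x / y)%:P) != 0 :> {poly L}.
  by rewrite !mulf_neq0 ?polyX_eq0 ?polyXsubC_eq0.
rewrite !rootM rootX !root_XsubC !negb_or => /andP[/andP[s0 sab] sxy].
have sab0 : a + s * b != 0.
  apply: contra_neq sab => E; apply: (mulIf b0); rewrite divfK //.
  by apply/eqP; rewrite -addr_eq0 addrC E.
exists (s * (a + s * b)), (a + s * b), (- s * c); split=> //.
- by rewrite qf_off3; ring.
- by rewrite mulf_neq0.
rewrite mulrAC (inj_eq (mulIf sab0)); apply: contra_neq sxy => <-.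
by rewrite mulfK.
Qed.

(** Three of the common points serve as coordinate points. If two of the ratios a' / a, b' / b, c' /
    c agree, the fourth common point forces the third ratio to agree too; the conics then coincide
    and share a fifth point. *)
Lemma meet_in_four_disc A B : A^T = A -> B^T = B -> \det A != 0 ->
  meet_in_four A B -> disc3 (sinv A B) != 0.
Proof.
move=> sA sB dA [P [onP [neqP allP]]].
have onA i := proj1 (onP i); have onB i := proj2 (onP i).
have dQ : \det (rows3 (P 0) (P 1) (P 2)) != 0.
  by apply: (@conic_points_indep _ two A); rewrite ?onA //; apply: neqP.
have [a [b [c QA]]] := gram_off3 sA (onA 0) (onA 1) (onA 2).
have [a' [b' [c' QB]]] := gram_off3 sB (onB 0) (onB 1) (onB 2).
set Q := rows3 _ _ _ in dQ QA QB.
have uQ : Q \in unitmx by rewrite unitmxE unitfE.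
have : \det (Q *m A *m Q^T) != 0 by rewrite !det_mulmx det_tr !mulf_neq0.
rewrite QA det_off3 !mulf_eq0 !negb_or => /andP[/andP[/andP[_ a0] b0] c0].
rewrite -(sinv_congr two B dQ dA) QA QB sinv_off3 // disc3_roots sqrf_eq0.
have PQ0 : P 0 = row3 1 0 0 *m Q by rewrite mul_rows3 scale1r !scale0r !addr0.
have PQ1 : P 1 = row3 0 1 0 *m Q by rewrite mul_rows3 scale1r !scale0r addr0 add0r.
have PQ2 : P 2 = row3 0 0 1 *m Q by rewrite mul_rows3 scale1r !scale0r !add0r.
have [x [y [z PQ3]]] : exists x y z, P 3 = row3 x y z *m Q.
  move: (mulmxKV uQ (P 3)); move: (P 3 *m _); apply: row3P => x y z <-.
  by exists x, y, z.
have [] := onA 3; rewrite PQ3 -qf_congr QA qf_off3 => w0 /eqP.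
rewrite mulf_eq0 (negPf two) => /eqP wA.
have [_] := onB 3; rewrite PQ3 -qf_congr QB qf_off3 => /eqP.
rewrite mulf_eq0 (negPf two) => /eqP wB.
(* No other [P k] can represent the fourth point; applied to the coordinate points, this will show
   that [x], [y] and [z] are all nonzero. *)
have notP k t e : P k = e *m Q -> row3 x y z = t *: e -> k = 3.
  move=> Pk E; apply/eqP; case: (eqVneq k 3) => // /eqP nk.
  have [] := neqP 3 k; first by rewrite eq_sym; apply/eqP.
  exists t; rewrite PQ3 Pk E scalemxAl; split=> //.
  by apply: contra_neq w0 => t0; rewrite E t0 scale0r mul0mx.
have zz t x1 x2 : t != 0 -> t * (x1 * x2) = 0 -> x1 = 0 \/ x2 = 0 :> L.
  move=> t0 /eqP; rewrite !mulf_eq0 (negPf t0) /=.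
  by case/orP=> /eqP; [left | right].
(* With x = 0 the equation of [A] reduces to a y z = 0, and the fourth point would be a coordinate
   point. *)
have x0 : x != 0.
  apply/eqP=> x0; move: wA notP; rewrite x0 !mul0r !mulr0 !addr0 => /(zz _ _ _ a0)[]->.
    by move=> /(_ _ z _ PQ2); rewrite scale_row3 !mulr0 mulr1 => /(_ erefl).
  by move=> /(_ _ y _ PQ1); rewrite scale_row3 !mulr0 mulr1 => /(_ erefl).
have y0 : y != 0.
  apply/eqP=> y0; move: wA notP; rewrite y0 !mul0r !mulr0 !addr0 !add0r => /(zz _ _ _ b0)[]->.
    by move=> /(_ _ z _ PQ2); rewrite scale_row3 !mulr0 mulr1 => /(_ erefl).
  by move=> /(_ _ x _ PQ0); rewrite scale_row3 !mulr0 mulr1 => /(_ erefl).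
have z0 : z != 0.
  apply/eqP=> z0; move: wA notP; rewrite z0 !mulr0 !add0r => /(zz _ _ _ c0)[]->.
    by move=> /(_ _ y _ PQ1); rewrite scale_row3 !mulr0 mulr1 => /(_ erefl).
  by move=> /(_ _ x _ PQ0); rewrite scale_row3 !mulr0 mulr1 => /(_ erefl).
apply/negP=> D0.
(* Proportional forms are contradictory: every point of [A] is common, and the extra point is none
   of the four. *)
suff [k [Ea Eb Ec]] : exists k, [/\ a' = k * a, b' = k * b & c' = k * c].
  have [X [Y [Z [q0 X0 Y0 XY]]]] := off3_extra_point x a0 b0 c0 y0.
  have v0 : row3 X Y Z != 0 by rewrite row3_eq0 (negPf X0).
  have SA : on_conic A (row3 X Y Z *m Q).
    by apply/(on_conic_congr dQ); rewrite QA.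
  have SB : on_conic B (row3 X Y Z *m Q).
    apply/(on_conic_congr dQ); rewrite QB; split=> //.
    rewrite qf_off3 Ea Eb Ec -[RHS](mulr0 k) -q0 qf_off3; ring.
  have np k' e : P k' = e *m Q -> proj_eq (row3 X Y Z *m Q) (P k') ->
      exists2 t, t != 0 & row3 X Y Z = t *: e.
    by move=> -> /(proj_eq_mul dQ)[t [t0 ->]]; exists t.
  have [i] := allP _ SA SB.
  move: i => [[|[|[|[|//]]]] i4].
  - rewrite (_ : Ordinal i4 = 0); last exact: val_inj.
    move=> /(np _ _ PQ0)[t _]; rewrite scale_row3 => Ep; have [EX [EY _]] := row3_inj Ep.
    by move: Y0; rewrite EY mulr0 eqxx.
  - rewrite (_ : Ordinal i4 = 1); last exact: val_inj.
    move=> /(np _ _ PQ1)[t _]; rewrite scale_row3 => Ep; have [EX [EY _]] := row3_inj Ep.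
    by move: X0; rewrite EX mulr0 eqxx.
  - rewrite (_ : Ordinal i4 = 2); last exact: val_inj.
    move=> /(np _ _ PQ2)[t _]; rewrite scale_row3 => Ep; have [EX [EY _]] := row3_inj Ep.
    by move: X0; rewrite EX mulr0 eqxx.
  - rewrite (_ : Ordinal i4 = 3); last exact: val_inj.
    move=> /(np _ _ PQ3)[t _]; rewrite scale_row3 => Ep; have [EX [EY _]] := row3_inj Ep.
    by move: XY; rewrite EX EY [t * x]mulrC mulrA eqxx.
set la := a' / a in D0; set lb := b' / b in D0; set lc := c' / c in D0.
have Ea : a' = la * a by rewrite divfK.
have Eb : b' = lb * b by rewrite divfK.
have Ec : c' = lc * c by rewrite divfK.
have kill t s : t != 0 -> s * t = 0 -> s = 0 :> L.
  by move=> t0 /eqP; rewrite mulf_eq0 (negPf t0) orbF => /eqP.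
(* This evaluates B - k A at the fourth point. When [k] is the value shared by two ratios, a single
   term survives and the third ratio equals [k]. *)
have cmb k : (la - k) * (a * (y * z)) + (lb - k) * (b * (x * z)) + (lc - k) * (c * (x * y)) = 0.
  by rewrite -[RHS](subrr 0) -{1}wB -(mulr0 k) -wA Ea Eb Ec; ring.
have [nza nzb nzc] : [/\ a * (y * z) != 0, b * (x * z) != 0 & c * (x * y) != 0].
  by split; rewrite !mulf_neq0.
move: D0; rewrite !mulf_eq0 => /orP[/orP[]|]; rewrite subr_eq0 => /eqP D.
- have := cmb la; rewrite -D subrr !mul0r !add0r => /(kill _ _ nzc)/eqP.
  by rewrite subr_eq0 => /eqP E; exists la; split; rewrite // ?Eb ?Ec ?E -?D.
- have := cmb lb; rewrite -D subrr !mul0r !addr0 => /(kill _ _ nza)/eqP.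
  by rewrite subr_eq0 => /eqP E; exists lb; split; rewrite // ?Ea ?Ec ?E -?D.
- have := cmb la; rewrite D subrr !mul0r addr0 add0r => /(kill _ _ nzb)/eqP.
  by rewrite subr_eq0 => /eqP E; exists la; split; rewrite // ?Eb ?Ec ?E ?D.
Qed.
End MeetInFour.

(** * Poncelet triangles and Cayley's condition *)

Section Poncelet.
Variable L : closedFieldType.
Hypothesis two : 2 != 0 :> L.
Implicit Types (A B : 'M[L]_3) (u v P Q S : 'rV[L]_3).

(** Restricted to a tangent line, the form has a single projective zero, so its discriminant
    vanishes. The field is closed, hence a nonzero discriminant would give two distinct zeros. *)
Lemma tangent_disc B P Q : B^T = B -> P != 0 -> Q != 0 -> ~ proj_eq P Q ->
  tangent B P Q -> (P *m B *m Q^T) 0 0 ^+ 2 = qf B P * qf B Q.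
Proof.
move=> sB P0 Q0 nPQ [R [_ [_ uR]]].
set p := qf B P; set q := qf B Q; set m := _ 0 0.
have pt x y : (x != 0) || (y != 0) -> x ^+ 2 * p + 2 * x * y * m + y ^+ 2 * q = 0 ->
    proj_eq (x *: P + y *: Q) R.
  move=> xy0 E; apply: uR; last by exists x, y.
  split; last by rewrite qfD.
  by apply: contraTneq xy0 => /(proj_indep P0 Q0 nPQ)[-> ->]; rewrite eqxx.
have uniq x y x' y' : (x != 0) || (y != 0) -> x ^+ 2 * p + 2 * x * y * m + y ^+ 2 * q = 0 ->
    (x' != 0) || (y' != 0) -> x' ^+ 2 * p + 2 * x' * y' * m + y' ^+ 2 * q = 0 ->
    x * y' = x' * y.
  move=> xy0 E xy0' E'; have [c [c0 Ec]] := proj_eq_trans (pt _ _ xy0 E) (proj_eq_sym (pt _ _ xy0' E')).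
  have : (x - c * x') *: P + (y - c * y') *: Q = 0.
    rewrite !scalerBl addrACA Ec -opprD scalerDr !scalerA; exact: subrr.
  case/(proj_indep P0 Q0 nPQ)=> /eqP; rewrite subr_eq0 => /eqP-> /eqP.
  by rewrite subr_eq0 => /eqP->; ring.
(* If p = 0, then (1, 0) is a zero and (- q, 2 m) would be another for m nonzero. Otherwise the
   zeros are (- m + d, p) and (- m - d, p) with d^2 = m^2 - p q, and uniqueness gives d = - d. *)
have [p0|p0] := eqVneq p 0.
  apply/eqP; rewrite p0 mul0r sqrf_eq0; apply/eqP.
  have [//|m0] := eqVneq m 0.
  have /eqP : 1 * (2 * m) = - q * 0.
    apply: uniq; rewrite ?p0 ?oner_eq0 ?mulf_neq0 ?orbT //; ring.
  by rewrite mul1r mulr0 mulf_eq0 (negPf two) (negPf m0).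
have [d dE] := sqrt_closed (m ^+ 2 - p * q).
have := uniq (- m + d) p (- m - d) p; rewrite p0 !orbT.
have e1 : (- m + d) ^+ 2 * p + 2 * (- m + d) * p * m + p ^+ 2 * q = 0.
  have -> : (- m + d) ^+ 2 * p + 2 * (- m + d) * p * m + p ^+ 2 * q =
    p * (d ^+ 2 - (m ^+ 2 - p * q)) by ring.
  by rewrite dE subrr mulr0.
have e2 : (- m - d) ^+ 2 * p + 2 * (- m - d) * p * m + p ^+ 2 * q = 0.
  have -> : (- m - d) ^+ 2 * p + 2 * (- m - d) * p * m + p ^+ 2 * q =
    p * (d ^+ 2 - (m ^+ 2 - p * q)) by ring.
  by rewrite dE subrr mulr0.
move=> /(_ isT e1 isT e2) /(mulIf p0)/addrI E.
have d0 : d = 0.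
  by apply/eqP; case: (eqVneq d 0) => // /(neq_opp two).
by move: dE; rewrite d0 expr0n /= => /esym/eqP; rewrite subr_eq0 => /eqP.
Qed.

(** In the basis of the vertices, tangency gives u^2 = p q, w^2 = q r, v^2 = r p for the entries of
    [B]. These determine [B] from [p], [u], [v] up to one sign, which det B fixes; the condition is
    then an identity. *)
Lemma poncelet_cayley A B : A^T = A -> B^T = B -> \det A != 0 -> \det B != 0 ->
  poncelet_triangle A B -> cayley (sinv A B).
Proof.
move=> sA sB dA dB [P1 [P2 [P3 [[o1 o2 o3] [[n1 n2 n3] [t1 t2 t3]]]]]].
have dQ := conic_points_indep two sA dA o1 o2 o3 n1 n2 n3.
have [a [b [c QA]]] := gram_off3 sA o1 o2 o3.
have [p10 p20 p30] := And3 (proj1 o1) (proj1 o2) (proj1 o3).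
have T1 := tangent_disc sB p10 p20 n1 t1.
have T2 := tangent_disc sB p20 p30 n2 t2.
have T3 := tangent_disc sB p30 p10 n3 t3.
have QB := gram_rows3 (P1 *m B) (P2 *m B) (P3 *m B) P1 P2 P3.
move: QB; rewrite -rows3_mul (bil_sym P2 P1 sB) (bil_sym P3 P2 sB) (bil_sym P1 P3 sB).
rewrite -/(qf B P1) -/(qf B P2) -/(qf B P3).
move: T1 T2 T3; set p := qf B P1; set q := qf B P2; set r := qf B P3.
set u := (P1 *m B *m P2^T) 0 0; set w := (P2 *m B *m P3^T) 0 0.
set v := (P3 *m B *m P1^T) 0 0.
set Q := rows3 _ _ _ in dQ QA *.
clearbody p q r u v w => Eu Ew Ev QB.
have : \det (Q *m A *m Q^T) != 0 by rewrite !det_mulmx det_tr !mulf_neq0.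
have : \det (Q *m B *m Q^T) != 0 by rewrite !det_mulmx det_tr !mulf_neq0.
rewrite -(sinv_congr two B dQ dA) QA QB det_off3.
rewrite !mulf_eq0 !negb_or => dM /andP[/andP[/andP[_ a0] b0] c0].
have dME : \det (mx3 p u v u q w v w r) = 2 * (u * v * w - p * q * r).
  rewrite det_mx3.
  have -> : p * q * r + u * w * v + v * u * w - p * w * w - u * u * r - v * q * v =
    p * q * r + 2 * (u * v * w) - p * w ^+ 2 - r * u ^+ 2 - q * v ^+ 2 by ring.
  by rewrite Eu Ew Ev; ring.
(* Only u v w = - p q r is compatible with det B = 2 (u v w - p q r) being nonzero, and this also
   excludes p = 0. *)
have : (u * v * w) ^+ 2 = (p * q * r) ^+ 2 by rewrite !exprMn Eu Ew Ev; ring.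
move/eqP; rewrite eqf_sqr => /orP[] /eqP Euvw.
  by move: dM; rewrite dME Euvw subrr mulr0 eqxx.
have [p0|p0] := eqVneq p 0.
  by move: dM; rewrite dME Euvw p0 !mul0r oppr0 addr0 mulr0 eqxx.
have Eq : q = u ^+ 2 / p by rewrite Eu mulrC mulKf.
have Er : r = v ^+ 2 / p by rewrite Ev mulfK.
have uv0 : u * v != 0.
  apply: contraNneq dM => uv0; rewrite dME -[p * q * r]opprK -Euvw.
  by rewrite uv0 mul0r oppr0 subr0 mulr0.
have Ewx : w = - (u * v) / p.
  apply: (mulfI uv0); rewrite Euvw Eq Er; field.
  by rewrite p0.
rewrite /cayley /sinv /s1 /s2 /s3 Eq Er Ewx /off3 !mx3E; apply/eqP; field.
have -> : c * a * b + b * c * a = 2 * a * b * c by ring.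
by rewrite p0 two !mulf_neq0.
Qed.

(** The coordinate triangle works: on each of its sides the second form restricts to the square of a
    difference of two coordinates, so the side is tangent. *)
Lemma poncelet_model (a b c : L) : poncelet_triangle (off3 a b c)
  (mx3 1 (- 1) (- 1) (- 1) 1 (- 1) (- 1) (- 1) 1).
Proof.
have one0 : (1 == 0 :> L) = false := oner_eq0 L.
exists (row3 1 0 0), (row3 0 1 0), (row3 0 0 1); split; last split.
- by split; rewrite /on_conic qf_off3 row3_eq0 one0 ?eqxx /=; split=> //; ring.
- split=> -[t [_]]; rewrite scale_row3 !mulr0 => E; have [e1 [e2 e3]] := row3_inj E.
  + by move/eqP: e1; rewrite one0.
  + by move/eqP: e2; rewrite one0.
  + by move/eqP: e3; rewrite one0.
have sq (x y : L) : (x - y) ^+ 2 = 0 -> x = y.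
  by move=> /eqP; rewrite sqrf_eq0 subr_eq0 => /eqP.
split.
- exists (row3 1 1 0); rewrite /on_conic row3_eq0 one0 qf_row3; do !split; first ring.
    by exists 1, 1; rewrite !scale_row3 add_row3; congr row3; ring.
  move=> S [S0 qS] [x [y E]]; move: S0 qS; rewrite E !scale_row3 add_row3 !mulr0 !mulr1.
  rewrite !addr0 !add0r qf_row3 => S0 qS.
  have xy : x = y by apply: sq; rewrite -qS; ring.
  exists x; split; last by rewrite scale_row3 -xy mulr0 mulr1.
  by apply: contraNneq S0 => x0; rewrite -xy x0 row3_eq0 eqxx.
- exists (row3 0 1 1); rewrite /on_conic row3_eq0 one0 qf_row3 !andbF; do !split; first ring.
    by exists 1, 1; rewrite !scale_row3 add_row3; congr row3; ring.
  move=> S [S0 qS] [x [y E]]; move: S0 qS; rewrite E !scale_row3 add_row3 !mulr0 !mulr1.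
  rewrite !addr0 !add0r qf_row3 => S0 qS.
  have xy : x = y by apply: sq; rewrite -qS; ring.
  exists x; split; last by rewrite scale_row3 -xy mulr0 mulr1.
  by apply: contraNneq S0 => x0; rewrite -xy x0 row3_eq0 eqxx.
- exists (row3 1 0 1); rewrite /on_conic row3_eq0 one0 qf_row3; do !split; first ring.
    by exists 1, 1; rewrite !scale_row3 add_row3; congr row3; ring.
  move=> S [S0 qS] [x [y E]]; move: S0 qS; rewrite E !scale_row3 add_row3 !mulr0 !mulr1.
  rewrite !addr0 !add0r qf_row3 => S0 qS.
  have xy : x = y by apply: sq; rewrite -qS; ring.
  exists x; split; last by rewrite scale_row3 -xy mulr0 mulr1.
  by apply: contraNneq S0 => x0; rewrite -xy x0 row3_eq0 eqxx.
Qed.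

Lemma cayley_poncelet A B : A^T = A -> B^T = B -> \det A != 0 -> \det B != 0 ->
  disc3 (sinv A B) != 0 -> cayley (sinv A B) -> poncelet_triangle A B.
Proof.
move=> sA sB dA dB D0 /eqP C.
have s30 : s3 A B != 0 by rewrite mulf_neq0 // invr_eq0.
have four0 : 4 != 0 :> L by rewrite (_ : 4 = 2 * 2) ?mulf_neq0 //; ring.
(* The cubic of the model involves only a + b + c and a b c. Matching [s2] and [s3] dictates these
   two values, and [s1] then matches by Cayley's condition. The sum a b + b c + c a is free and is
   set to 0. *)
have [a [b [c [E1 E2 E3]]]] := cubic_roots (- s2 A B / s3 A B) 0 (- 2 / s3 A B).
have abc0 : a * b * c != 0 by rewrite -E3 mulf_neq0 ?invr_eq0 // oppr_eq0.
pose B' : 'M[L]_3 := mx3 1 (- 1) (- 1) (- 1) 1 (- 1) (- 1) (- 1) 1.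
have dA' : \det (off3 a b c) = - 4 / s3 A B.
  by rewrite det_off3 -[2 * a * b]mulrA -mulrA -E3; field.
have dA'0 : \det (off3 a b c) != 0.
  by rewrite dA' mulf_neq0 ?invr_eq0 // oppr_eq0.
have Es : sinv A B = sinv (off3 a b c) B'.
  apply/esym/sinvP => // t.
  have -> : \det (t *: off3 a b c + B') = 2 * (a * b * c) * t ^+ 3
      - (a + b + c) ^+ 2 * t ^+ 2 + 4 * (a + b + c) * t - 4.
    by rewrite /off3 !mx3E; ring.
  have Es1 : s1 A B = s2 A B ^+ 2 / (4 * s3 A B).
    by rewrite C; field; rewrite s30 four0.
  rewrite dA' -E1 -E3 Es1; field. by rewrite s30 four0.
have [M [dM MA MB]] : exists M, [/\ \det M != 0, M *m A *m M^T = off3 a b c & M *m B *m M^T = B'].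
  by apply: pencil_congr; rewrite // tr_mx3.
by apply: (poncelet_congr dM); rewrite MA MB; apply: poncelet_model.
Qed.

End Poncelet.

(** * Pairs with a prescribed separable cubic *)

Lemma card_can_in (T U : finType) (A : {set T}) (B : {set U}) (u : T -> U) (v : U -> T) :
  {in A, forall x, u x \in B} -> {in B, forall y, v y \in A} ->
  {in A, cancel u v} -> {in B, cancel v u} -> #|A| = #|B|.
Proof.
move=> uB vA uK vK; apply/eqP; rewrite eqn_leq.
rewrite -{1}(card_in_imset (can_in_inj uK)) -{2}(card_in_imset (can_in_inj vK)).
by apply/andP; split; apply: subset_leq_card; apply/subsetP=> _ /imsetP[x xA ->]; auto.
Qed.

Section Hyperplanes.
Variables (F : finFieldType) (L : fieldType) (f : {rmorphism F -> L}).

(** The coefficients of [w] lie in the larger field, but one nonzero coefficient [w 0 k] still lets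
    the other coordinates of [v] determine [v 0 k]. *)
Lemma card_hyperplane (w : 'rV[L]_3) : w != 0 ->
  (#|[set v : 'rV[F]_3 | (map_mx f v *m w^T) 0%R 0%R == 0%R]| <= #|F| ^ 2)%N.
Proof.
case/rV0Pn=> k wk; rewrite -(card_mx F 1 2) -cardsT.
set Z := [set v | _]; have inj : {in Z &, injective (col' k : 'rV[F]_3 -> 'rV_2)}.
  move=> v v'; rewrite !inE => /eqP Ev /eqP Ev' E.
  have off j : j != k -> v 0 j = v' 0 j.
    rewrite eq_sym => /unlift_some[i -> _].
    by move/rowP/(_ i): E; rewrite !mxE.
  apply/rowP=> j; have [->|] := eqVneq j k; last exact: off.
  apply: (fmorph_inj f); apply: (mulIf wk).
  move: Ev'; rewrite -{}Ev !mxE (bigD1 k) //= [RHS](bigD1 k) //= !mxE.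
  under eq_bigr => i ik do rewrite !mxE -(off i ik).
  under [in RHS]eq_bigr => i ik do rewrite !mxE.
  by move/addIr.
rewrite -(card_in_imset inj); exact/subset_leq_card/subsetT.
Qed.

(** Three such sets have at most 3 q^2 < q^3 elements together. The vector obtained is the cyclic
    vector of [cyclic_basis]. *)
Lemma avoid_hyperplanes (w0 w1 w2 : 'rV[L]_3) : (3 < #|F|)%N ->
  w0 != 0 -> w1 != 0 -> w2 != 0 ->
  exists v : 'rV[F]_3, [/\ (map_mx f v *m w0^T) 0 0 != 0,
    (map_mx f v *m w1^T) 0 0 != 0 & (map_mx f v *m w2^T) 0 0 != 0].
Proof.
move=> q3 w00 w10 w20.
pose Z (w : 'rV[L]_3) := [set v : 'rV[F]_3 | (map_mx f v *m w^T) 0 0 == 0].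
have : ~~ ([set: 'rV[F]_3] \subset Z w0 :|: Z w1 :|: Z w2).
  apply/negP=> /subset_leq_card; rewrite cardsT card_mx mul1n leqNgt => /negP[].
  apply: (@leq_ltn_trans (3 * #|F| ^ 2)%N); last first.
    by rewrite [(#|F| ^ 3)%N]expnS ltn_pmul2r // expn_gt0; case: #|F| q3.
  rewrite 2!mulSn mul1n addnA.
  apply: leq_trans (leq_card_setU _ _) _; apply: leq_add; last exact: card_hyperplane.
  by apply: leq_trans (leq_card_setU _ _) _; apply: leq_add; exact: card_hyperplane.
case/subsetPn=> v _; rewrite !inE !negb_or => /andP[/andP[v0 v1] v2].
by exists v.
Qed.

End Hyperplanes.

(** * Companion and Hankel matrices *)

Section Companion.
Variable K : fieldType.
Hypothesis two : 2 != 0 :> K.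
Implicit Types (A B X g h : 'M[K]_3).

Lemma sinv1_mx3 (a b c d e f g h i : K) :
  sinv 1%:M (mx3 a b c d e f g h i) =
  (a + e + i, a * e - b * d + a * i - c * g + e * i - f * h,
   \det (mx3 a b c d e f g h i)).
Proof.
have d1 : \det (1%:M : 'M[K]_3) = 1 by rewrite det1.
apply: sinvP => //; first by rewrite d1 oner_eq0.
by move=> t; rewrite d1 !mx3E; ring.
Qed.

Lemma cayley_hamilton3 X :
  X *m X *m X = s1 1%:M X *: (X *m X) - s2 1%:M X *: X + (s3 1%:M X)%:M.
Proof.
move: X; apply: mx3P => a b c d e f g h i.
have [-> -> ->] := sinv1_mx3 a b c d e f g h i.
by rewrite !mx3E; congr mx3; ring.
Qed.

(** Since t A + X A = (t + X) A, the invariants of the pair are, up to signs, the coefficients of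
    the characteristic polynomial of [X]. *)
Lemma sinv_mulr A X : \det A != 0 -> sinv A (X *m A) = sinv 1%:M X.
Proof.
move=> dA; apply: sinvP => // t.
rewrite -mul_scalar_mx -mulmxDl det_mulmx -scalemx1 det_pencil ?det1 ?oner_eq0 //.
by ring.
Qed.

Lemma sinv_conj g X Y : \det g != 0 -> g *m X = Y *m g -> sinv 1%:M X = sinv 1%:M Y.
Proof.
have d1 : \det (1%:M : 'M[K]_3) != 0 by rewrite det1 oner_eq0.
move=> dg E; apply: sinvP => // t; rewrite -(det_pencil two Y t d1).
apply: (mulfI dg); rewrite -det_mulmx [RHS]mulrC -det_mulmx.
by rewrite mulmxDl mulmxDr E -scalemxAl -scalemxAr mul1mx mulmx1.
Qed.

(** Companion matrix of t^3 - e1 t^2 + e2 t - e3, acting on the rows v, v X, v X^2. *)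
Definition comp3 (e1 e2 e3 : K) : 'M[K]_3 := mx3 0 1 0 0 0 1 e3 (- e2) e1.

Lemma sinv_comp3 e1 e2 e3 : sinv 1%:M (comp3 e1 e2 e3) = (e1, e2, e3).
Proof. by rewrite sinv1_mx3 det_mx3; congr (_, _, _); ring. Qed.

(* The Hankel matrix of the linear recurrence with initial values 0, 0, 1. *)
Definition hankel3 (e1 e2 : K) : 'M[K]_3 :=
  mx3 0 0 1 0 1 e1 1 e1 (e1 ^+ 2 - e2).

Lemma det_hankel3 e1 e2 : \det (hankel3 e1 e2) = - 1.
Proof. by rewrite det_mx3; ring. Qed.

(** Multiplication by the companion matrix shifts the recurrent sequence by one step, so the product
    is again a Hankel matrix, hence symmetric. *)
Lemma comp3_hankel3 e1 e2 e3 :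
  comp3 e1 e2 e3 *m hankel3 e1 e2 = hankel3 e1 e2 *m (comp3 e1 e2 e3)^T.
Proof. by rewrite !mx3E; congr mx3; ring. Qed.

(** A matrix commuting with C is a polynomial in C, and C H = H C^T makes each p(C) H symmetric.
    Concretely, commutation expresses the lower rows of [h] through its first row. *)
Lemma commutant_hankel3 e1 e2 e3 h :
  h *m comp3 e1 e2 e3 = comp3 e1 e2 e3 *m h ->
  (h *m hankel3 e1 e2)^T = h *m hankel3 e1 e2.
Proof.
move: h; apply: mx3P => a b c d e f g h i.
rewrite !mul_mx3 !(mulr0, mul0r, mulr1, mul1r, addr0, add0r) => E.
have [[Ed [Ee Ef]] [[Eg [Eh Ei]] _]] := mx3_inj E.
rewrite tr_mx3 -Eg -Eh -Ei -Ed -Ee -Ef; congr mx3; ring.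
Qed.

End Companion.

Section Count.
Variables (F : finFieldType) (L : closedFieldType) (f : {rmorphism F -> L}).
Hypothesis two : 2 != 0 :> F.
Hypothesis q3 : (3 < #|F|)%N.
Variables e1 e2 e3 : F.
Hypothesis disc0 : disc3 (e1, e2, e3) != 0.
Implicit Types (A B X g h : 'M[F]_3).

Let C := comp3 e1 e2 e3.
Let H := hankel3 e1 e2.

Lemma two_neq0_map : 2 != 0 :> L.
Proof. by rewrite -(rmorph_nat f) fmorph_eq0. Qed.

(** Over the closure [X] has three distinct eigenvalues. A vector [v] over [F] pairing nontrivially
    with the three column eigenvectors is cyclic, and Cayley-Hamilton gives the last row of the
    companion matrix. *)
Lemma cyclic_basis X : sinv 1%:M X = (e1, e2, e3) ->
  exists2 g, \det g != 0 & g *m X = C *m g.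
Proof.
move=> EX; have [l0 [l1 [l2 [E1 E2 E3]]]] := cubic_roots (f e1) (f e2) (f e3).
have : disc3 (f e1, f e2, f e3) != 0 by rewrite disc3_map fmorph_eq0.
rewrite E1 E2 E3 disc3_roots sqrf_eq0 !mulf_eq0 !negb_or.
move=> /andP[/andP[d01 d12] d20].
have d1 : \det (1%:M : 'M[L]_3) != 0 by rewrite det1 oner_eq0.
have EXf : sinv 1%:M (map_mx f X) = (f e1, f e2, f e3).
  by move: EX => [<- <- <-]; rewrite -sinv_map map_mx1.
have eig l : (l - l0) * (l - l1) * (l - l2) = 0 ->
    exists2 w : 'rV[L]_3, w != 0 & map_mx f X *m w^T = l *: w^T.
  move=> rl; have : \det (map_mx f X - l *: 1%:M)^T == 0.
    move: EXf => [Ef1 Ef2 Ef3].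
    rewrite det_tr (det_pencilN two_neq0_map _ _ d1) Ef1 Ef2 Ef3 E1 E2 E3 det1 mul1r.
    by rewrite -[eqbRHS]oppr0 -rl; apply/eqP; ring.
  case/det0P=> w w0 /(congr1 trmx); rewrite trmx_mul trmxK trmx0 mulmxBl.
  by rewrite -scalemxAl mul1mx => /eqP; rewrite subr_eq0 => /eqP E; exists w.
have [w0 w00 w0X] : exists2 w : 'rV[L]_3, w != 0 & map_mx f X *m w^T = l0 *: w^T.
  by apply: eig; ring.
have [w1 w10 w1X] : exists2 w : 'rV[L]_3, w != 0 & map_mx f X *m w^T = l1 *: w^T.
  by apply: eig; ring.
have [w2 w20 w2X] : exists2 w : 'rV[L]_3, w != 0 & map_mx f X *m w^T = l2 *: w^T.
  by apply: eig; ring.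
have [v [v0 v1 v2]] := avoid_hyperplanes f q3 w00 w10 w20.
exists (rows3 v (v *m X) (v *m X *m X)).
  apply/eqP=> /rows3_dep[a [b [c [nz E]]]].
  (* Pairing a relation among v, v X, v X^2 with an eigenvector shows that its eigenvalue is a root
     of a + b l + c l^2; three distinct roots force a = b = c = 0. *)
  have ev (w : 'rV[L]_3) (l : L) : map_mx f X *m w^T = l *: w^T ->
      (map_mx f v *m w^T) 0 0 != 0 -> f a + f b * l + f c * l ^+ 2 = 0.
    move=> wX vw; apply: (mulIf vw); rewrite mul0r.
    have /(congr1 (fun M : 'M_(1, 1) => M 0 0)) :
        map_mx f (a *: v + b *: (v *m X) + c *: (v *m X *m X)) *m w^T = 0.
      by rewrite E map_mx0 mul0mx.
    rewrite !map_mxD !map_mxZ !map_mxM !mulmxDl -!scalemxAl -!mulmxA wX.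
    rewrite -!scalemxAr wX -!scalemxAr !scalerA mxE [X in X + _]mxE.
    rewrite ![(_ *: (_ : 'M_(_, _))) 0 0]mxE [RHS]mxE => <-; ring.
  have V0 := ev _ _ w0X v0; have V1 := ev _ _ w1X v1; have V2 := ev _ _ w2X v2.
  have k01 : f b + f c * (l0 + l1) = 0.
    apply: (mulfI d01); rewrite mulr0 -(subrr 0) -{1}V0 -V1; ring.
  have k12 : f b + f c * (l1 + l2) = 0.
    apply: (mulfI d12); rewrite mulr0 -(subrr 0) -{1}V1 -V2; ring.
  have kc : f c = 0.
    apply: (mulfI d20); rewrite mulr0 -(subrr 0) -{1}k12 -k01; ring.
  have kb : f b = 0 by move: k01; rewrite kc mul0r addr0.
  have ka : f a = 0 by move: V0; rewrite kb kc !mul0r !addr0.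
  by case/negP: nz; rewrite -!(fmorph_eq0 f) ka kb kc eqxx.
rewrite /C /comp3 -rows3_row3 !rows3_mul !mul_rows3 !scale0r !scale1r !add0r ?addr0.
congr rows3; move: EX => [X1 X2 X3].
have := cayley_hamilton3 two X; rewrite X1 X2 X3 => CH.
rewrite -!mulmxA [X *m (X *m X)]mulmxA CH mulmxDr mulmxBr -!scalemxAr mul_mx_scalar.
by rewrite scaleNr addrC addrA addrAC -addrA addrC.
Qed.

(* The choice depends on X alone, so it can be recomputed when inverting the
   bijection below. *)
Definition cyc_basis X : 'M[F]_3 :=
  odflt 1%:M [pick g | (\det g != 0) && (g *m X == C *m g)].

Lemma cyc_basisP X : (exists2 g, \det g != 0 & g *m X = C *m g) ->
  \det (cyc_basis X) != 0 /\ cyc_basis X *m X = C *m cyc_basis X.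
Proof.
rewrite /cyc_basis; case: pickP => [g /andP[dg /eqP E] // | no [g dg E]].
by have := no g; rewrite dg E eqxx.
Qed.

Lemma card_pairs :
  #|[set AB : 'M[F]_3 * 'M[F]_3 | [&& AB.1^T == AB.1, AB.2^T == AB.2,
      \det AB.1 != 0 & sinv AB.1 AB.2 == (e1, e2, e3)]]| =
  #|[set g : 'M[F]_3 | \det g != 0]|.
Proof.
have um (M : 'M[F]_3) : \det M != 0 -> M \in unitmx by rewrite unitmxE unitfE.
have mu (M : 'M[F]_3) : M \in unitmx -> \det M != 0 by rewrite unitmxE unitfE.
have uH : H \in unitmx by apply: um; rewrite det_hankel3 oppr_eq0 oner_eq0.
have CH : C *m H = H *m C^T by exact: comp3_hankel3.
have HC : invmx H *m C = C^T *m invmx H.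
  by rewrite -[LHS](mulmxK uH) -(mulmxA _ C H) CH mulKmx.
(* The map [u] sends (A, B) to G = h g with h = g A g^T H^-1. As h commutes with C, [v] recovers X =
   G^-1 C G, hence the chosen g, then h = G g^-1 and finally A and B = X A. *)
pose u (AB : 'M[F]_3 * 'M[F]_3) :=
  let g := cyc_basis (AB.2 *m invmx AB.1) in g *m AB.1 *m g^T *m invmx H *m g.
pose v (G : 'M[F]_3) := let X := invmx G *m C *m G in let g := cyc_basis X in
  let A := invmx g *m (G *m invmx g *m H) *m (invmx g)^T in (A, X *m A).
have uP A B : A^T = A -> B^T = B -> \det A != 0 -> sinv A B = (e1, e2, e3) ->
    u (A, B) \in unitmx /\ v (u (A, B)) = (A, B).
  move=> sA sB dA EAB; have uA := um _ dA.
  rewrite /u /=; set X := B *m invmx A.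
  have XA : X *m A = B by rewrite mulmxKV.
  have EX : sinv 1%:M X = (e1, e2, e3) by rewrite -(sinv_mulr two X dA) XA.
  have [dg gX] := cyc_basisP (cyclic_basis EX).
  set g := cyc_basis X in dg gX *; have ug := um _ dg.
  set A' := g *m A *m g^T.
  have sA' : A'^T = A' by rewrite !trmx_mul trmxK sA mulmxA.
  (* The product C A' equals g B g^T, so the symmetry of [B] yields this relation and with it the
     commutation of [h] with C. *)
  have CA' : C *m A' = A' *m C^T.
    have -> : C *m A' = g *m B *m g^T by rewrite /A' !mulmxA -gX -XA !mulmxA.
    rewrite -sA' -trmx_mul.
    have -> : C *m A' = g *m B *m g^T by rewrite /A' !mulmxA -gX -XA !mulmxA.
    by rewrite !trmx_mul trmxK sB mulmxA.
  set h := A' *m invmx H.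
  have hC : h *m C = C *m h by rewrite /h -mulmxA HC mulmxA -CA' -mulmxA.
  have uA' : A' \in unitmx by rewrite /A' !unitmx_mul unitmx_tr ug uA.
  have uh : h \in unitmx by rewrite /h unitmx_mul unitmx_inv uA' uH.
  have uG : h *m g \in unitmx by rewrite unitmx_mul uh ug.
  split=> //.
  have EG : invmx (h *m g) *m C *m (h *m g) = X.
    have E : h *m g *m X = C *m (h *m g) by rewrite -mulmxA gX mulmxA hC -mulmxA.
    by rewrite -mulmxA -E mulKmx.
  rewrite /v EG -/g mulmxK // /h mulmxKV // /A'.
  have -> : invmx g *m (g *m A *m g^T) *m (invmx g)^T = A.
    by rewrite -!mulmxA mulKmx // -trmx_mul mulVmx // trmx1 mulmx1.
  by rewrite XA.
have vP G : \det G != 0 -> let: (A, B) := v G in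
    [/\ A^T = A, B^T = B, \det A != 0, sinv A B = (e1, e2, e3) & u (A, B) = G].
  move=> dG; have uG := um _ dG; rewrite /v.
  set X := invmx G *m C *m G.
  have GX : G *m X = C *m G by rewrite /X -mulmxA mulKVmx.
  (* Here [G] itself conjugates [X] to C, so the choice made in [cyc_basis] is not the default
     one. *)
  have [dg gX] : \det (cyc_basis X) != 0 /\ cyc_basis X *m X = C *m cyc_basis X.
    by apply: cyc_basisP; exists G.
  move: dg gX; move Eg : (cyc_basis X) => g dg gX; have ug := um _ dg.
  clearbody X; set h := G *m invmx g; have hg : h *m g = G by rewrite mulmxKV.
  have hC : h *m C = C *m h.
    rewrite -[LHS](mulmxK ug) -[h *m C *m g]mulmxA -gX mulmxA hg GX -mulmxA.
    by [].
  have uh : h \in unitmx by rewrite /h unitmx_mul unitmx_inv uG ug.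
  set H' := h *m H; have sH' : H'^T = H' by exact: commutant_hankel3 hC.
  set A := invmx g *m H' *m (invmx g)^T.
  have sA : A^T = A by rewrite /A trmx_mul trmxK (trmx_mul _ H') sH' mulmxA.
  have uA : A \in unitmx.
    have uH' : H' \in unitmx by rewrite /H' unitmx_mul uh uH.
    by rewrite /A 2!unitmx_mul unitmx_tr unitmx_inv ug uH'.
  have gA : g *m A *m g^T = H'.
    by rewrite /A !mulmxA mulmxV // mul1mx -mulmxA -trmx_mul mulmxV // trmx1 mulmx1.
  have CHs : (C *m H')^T = C *m H'.
    by rewrite trmx_mul sH' /H' -mulmxA -CH mulmxA hC -mulmxA.
  clearbody A; have XA : g *m (X *m A) *m g^T = C *m H'.
    by rewrite -gA !mulmxA gX.
  have {}XA : X *m A = invmx g *m (C *m H') *m (invmx g)^T.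
    rewrite -XA !mulmxA mulVmx // mul1mx -(mulmxA _ g^T) -trmx_mul mulVmx //.
    by rewrite trmx1 mulmx1.
  split=> //.
  - by rewrite XA trmx_mul trmxK (trmx_mul _ (C *m H')) CHs mulmxA.
  - exact: mu.
  - by rewrite (sinv_mulr two _ (mu _ uA)) (sinv_conj two dG GX) sinv_comp3.
  - by rewrite /u /= mulmxK // Eg gA /H' mulmxK.
apply: (@card_can_in _ _ _ _ u v).
- move=> [A B]; rewrite !inE /= => /and4P[/eqP sA /eqP sB dA /eqP EAB].
  by apply: mu; case: (uP _ _ sA sB dA EAB).
- move=> G; rewrite !inE => /vP; case: (v G) => A B [sA sB dA EAB _] /=.
  by rewrite sA sB dA EAB !eqxx.
- move=> [A B]; rewrite !inE /= => /and4P[/eqP sA /eqP sB dA /eqP EAB].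
  by case: (uP _ _ sA sB dA EAB).
- by move=> G; rewrite !inE => /vP; case: (v G) => A B [].
Qed.

End Count.

(** * Counting cubics *)

Section FiniteField.
Variable F : finFieldType.
Hypotheses (two : 2 != 0 :> F) (three : 3 != 0 :> F).

Lemma card_gt3 : (3 < #|F|)%N.
Proof.
have one0 := oner_neq0 F.
have : uniq [:: 0; 1; -1; 2 : F].
  rewrite /= !inE !negb_or ![0 == _]eq_sym oner_eq0 oppr_eq0 oner_eq0 two /=.
  rewrite -subr_eq0 opprK two /= -subr_eq0 (_ : 1 - 2 = - 1); last by ring.
  by rewrite oppr_eq0 oner_eq0 /= andbT eq_sym -addr_eq0 (_ : 2 + 1 = 3) //; ring.
move/card_uniqP=> /= E.
by have := max_card (mem [:: 0; 1; -1; 2 : F]); rewrite E.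
Qed.

Lemma card_cubic_nonroots (c0 c1 c2 c3 : F) : c3 != 0 ->
  (#|F| - 3 <= #|[set x : F | (c0 + c1 * x + c2 * x ^+ 2 + c3 * x ^+ 3 != 0)%R]|)%N.
Proof.
move=> c30; pose p := Poly [:: c0; c1; c2; c3].
have p0 : p != 0.
  by apply: contra_neq c30 => p0; have := coef_Poly [:: c0; c1; c2; c3] 3; rewrite -/p p0 coef0.
set Z := [set x | _]; rewrite leq_subLR -(cardsC Z) addnC leq_add2r.
have : all (root p) (enum (~: Z)).
  apply/allP=> x; rewrite mem_enum !inE negbK => /eqP E.
  by rewrite /root horner_Poly /=; apply/eqP; rewrite -[RHS]E; ring.
move=> /(max_poly_roots p0)/(_ (enum_uniq _)); rewrite -cardE => lt.
by rewrite -ltnS; apply: leq_trans lt (size_Poly _).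
Qed.

(** The component [e.2] is [s3], the quotient of det B by det A, so its nonvanishing expresses that
    [B] is nonsingular. *)
Definition transverse (e : F * F * F) := (e.2 != 0) && (disc3 e != 0).

Lemma card_set_pair (S T : finType) (P : pred (S * T)) :
  #|[set x | P x]| = (\sum_s #|[set t | P (s, t)]|)%N.
Proof.
under [RHS]eq_bigr => s _ do rewrite -sum1dep_card.
by rewrite pair_big_dep -sum1dep_card; apply: eq_bigl => -[].
Qed.

(** For fixed [e1] and [e2], the product of e3 and the discriminant is a polynomial in e3 with
    leading term - 27 e3^3, so at most three values of e3 are excluded. *)
Lemma card_transverse_ge : (#|F| ^ 2 * (#|F| - 3) <= #|[set e | transverse e]|)%N.
Proof.
rewrite card_set_pair -mulnn -card_prod -sum_nat_const.
apply: leq_sum => -[e1 e2] _.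
have c0 : - 27 != 0 :> F.
  by rewrite oppr_eq0 (_ : 27 = 3 * (3 * 3)) ?mulf_neq0 //; ring.
apply: leq_trans (card_cubic_nonroots 0 (e1 ^+ 2 * e2 ^+ 2 - 4 * e2 ^+ 3)
  (18 * e1 * e2 - 4 * e1 ^+ 3) c0) _.
apply/subset_leq_card/subsetP=> x; rewrite !inE /transverse /=.
rewrite -negb_or -mulf_eq0; apply: contra => /eqP E; apply/eqP.
by rewrite -[RHS]E; ring.
Qed.

Lemma card_transverse_le : (#|[set e | transverse e]| <= #|F| ^ 2 * (#|F| - 1))%N.
Proof.
rewrite -mulnn -card_prod -cardsT subn1 -(cardsC1 (0 : F)) -cardsX.
apply/subset_leq_card/subsetP=> -[s x]; rewrite !inE /transverse /=.
by case/andP.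
Qed.

Lemma four_neq0 : 4 != 0 :> F.
Proof. by rewrite (_ : 4 = 2 * 2) ?mulf_neq0 //; ring. Qed.

(** Cayley's condition determines e1 = e2^2 / (4 e3) from the other two coefficients. *)
Lemma card_cayley_le :
  (#|[set e | transverse e && cayley e]| <= #|F| * (#|F| - 1))%N.
Proof.
rewrite -[X in (_ <= X * _)%N]cardsT subn1 -(cardsC1 (0 : F)) -cardsX.
pose h (e : F * F * F) := (e.1.2, e.2).
rewrite -(@card_in_imset _ _ h); last first.
  move=> [[e1 e2] e3] [[e1' e2'] e3']; rewrite !inE /transverse /cayley /=.
  move=> /andP[/andP[e30 _] /eqP E] /andP[_ /eqP E'] [E2 E3].
  congr (_, _, _) => //; apply: (mulfI four_neq0); apply: (mulIf e30).
  by rewrite -E E2 E' E3.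
apply/subset_leq_card/subsetP=> _ /imsetP[[[e1 e2] e3] + ->].
by rewrite !inE /transverse /= => /andP[/andP[]].
Qed.

Lemma card_cayley_ge :
  (#|F| * (#|F| - 3) <= #|[set e | transverse e && cayley e]|)%N.
Proof.
(* After substituting e1 = e2^2 / (4 e3), the discriminant becomes e2^3 / 2 - 27 e3^2. Here [P] says
   that e3 times this value is nonzero, for [x] = (e2, e3). *)
pose P (x : F * F) := 0 + (x.1 ^+ 3 / 2) * x.2 + 0 * x.2 ^+ 2 + (- 27) * x.2 ^+ 3 != 0.
have c0 : - 27 != 0 :> F.
  by rewrite oppr_eq0 (_ : 27 = 3 * (3 * 3)) ?mulf_neq0 //; ring.
apply: (@leq_trans #|[set x | P x]|).
  rewrite card_set_pair -sum_nat_const; apply: leq_sum => s _.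
  apply: leq_trans (card_cubic_nonroots 0 (s ^+ 3 / 2) 0 c0) _.
  by apply/subset_leq_card/subsetP=> x; rewrite !inE.
pose h (x : F * F) := (x.1 ^+ 2 / (4 * x.2), x.1, x.2).
rewrite -(@card_imset _ _ h); last by move=> [a b] [a' b'] [_ -> ->].
apply/subset_leq_card/subsetP=> _ /imsetP[[x y] + ->]; rewrite !inE /P /= => nz.
have y0 : y != 0.
  by apply: contraNneq nz => ->; apply/eqP; ring.
rewrite /transverse /cayley /= y0 /=; apply/andP; split; last first.
  by apply/eqP; field; rewrite y0 four_neq0.
apply: contraNneq nz => E; apply/eqP.
rewrite -[RHS](mulr0 y) -[in RHS]E; field.
by rewrite y0 four_neq0 two.
Qed.

(** * From conics to symmetric matrices *)

Definition pivot (M : 'M[F]_3) : F :=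
  if [pick k : 'I_3 * 'I_3 | M k.1 k.2 != 0] is Some k then M k.1 k.2 else 0.

Lemma normalizedE M : normalized M = (pivot M == 1).
Proof.
by rewrite /normalized /pivot; case: pickP => // _; rewrite eq_sym oner_eq0.
Qed.

Lemma pivotZ x M : x != 0 -> pivot (x *: M) = x * pivot M.
Proof.
move=> x0; rewrite /pivot.
rewrite (@eq_pick _ _ (fun k : 'I_3 * 'I_3 => M k.1 k.2 != 0)).
  by case: pickP => [k _|_]; rewrite ?mulr0 // mxE.
by move=> k; rewrite mxE mulf_eq0 (negPf x0).
Qed.

Lemma pivot_neq0 M : M != 0 -> pivot M != 0.
Proof.
apply: contra_neq; rewrite /pivot; case: pickP => [k nz E|no _].
  by rewrite E eqxx in nz.
by apply/matrixP=> i j; rewrite mxE; apply/eqP; have /negbFE := no (i, j).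
Qed.

(** A nonzero matrix is uniquely its pivot times a normalized matrix, so each pair of conics
    accounts for (q - 1)^2 pairs of matrices. *)
Lemma card_conic_pairs (P : pred ('M[F]_3 * 'M[F]_3)) :
  (forall A B, P (A, B) -> A != 0 /\ B != 0) ->
  (forall x y A B, x != 0 -> y != 0 -> P (x *: A, y *: B) = P (A, B)) ->
  #|[set AB | [&& AB.1^T == AB.1, AB.2^T == AB.2 & P AB]]| =
  (#|F|.-1 * #|F|.-1 * #|[set AB | [&& conic_rep AB.1, conic_rep AB.2 & P AB]]|)%N.
Proof.
move=> P0 PZ; rewrite -(cardsC1 (0 : F)) -!cardsX.
pose u (AB : 'M[F]_3 * 'M[F]_3) :=
  ((pivot AB.1, pivot AB.2), ((pivot AB.1)^-1 *: AB.1, (pivot AB.2)^-1 *: AB.2)).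
pose v (z : (F * F) * ('M[F]_3 * 'M[F]_3)) := (z.1.1 *: z.2.1, z.1.2 *: z.2.2).
have trZ (x : F) (M : 'M[F]_3) : M^T = M -> (x *: M)^T = x *: M.
  by move=> sM; rewrite linearZ /= sM.
apply: (@card_can_in _ _ _ _ u v).
- move=> [A B]; rewrite !inE /conic_rep !normalizedE /= => /and3P[/eqP sA /eqP sB PAB].
  have [A0 B0] := P0 _ _ PAB; have pA := pivot_neq0 A0; have pB := pivot_neq0 B0.
  by rewrite pA pB !trZ // !eqxx !pivotZ ?invr_eq0 // !mulVf // !eqxx PZ ?invr_eq0.
- move=> [[x y] [A B]]; rewrite !inE /conic_rep /=.
  move=> /andP[/andP[x0 y0] /and3P[/andP[/eqP sA _] /andP[/eqP sB _] PAB]].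
  by rewrite !trZ // !eqxx PZ.
- move=> [A B]; rewrite !inE /v /= => /and3P[_ _ PAB].
  have [A0 B0] := P0 _ _ PAB; have pA := pivot_neq0 A0; have pB := pivot_neq0 B0.
  by rewrite !scalerA !divff // !scale1r.
- move=> [[x y] [A B]]; rewrite !inE /conic_rep !normalizedE /u /=.
  move=> /andP[/andP[x0 y0] /and3P[/andP[_ /eqP pA] /andP[_ /eqP pB] PAB]].
  by rewrite !pivotZ // pA pB !mulr1 !scalerA !mulVf // !scale1r.
Qed.

End FiniteField.

(** The counts give (x - 3) / (x (x - 1)) <= N / M <= (x - 1) / (x (x - 3)); the stated bounds are
    weaker, as cross-multiplication shows. *)
Lemma ratio_bounds (R : realFieldType) (x N M : R) : 4 <= x -> 0 <= N ->
  x * (x - 3) <= N -> N <= x * (x - 1) ->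
  x ^+ 2 * (x - 3) <= M -> M <= x ^+ 2 * (x - 1) ->
  (x - 16) / (x * (x + 1)) <= N / M /\ N / M <= (x + 5) / ((x - 2) * (x - 3)).
Proof.
move=> x4 N0 N1 N2 M1 M2.
have x0 : 0 < x by lra.
have x1 : 0 < x + 1 by lra.
have x2 : 0 < x - 2 by lra.
have x3 : 0 < x - 3 by lra.
have M0 : 0 < M by apply: lt_le_trans M1; rewrite mulr_gt0 // exprn_gt0.
split.
  rewrite ler_pdivlMr // mulrAC ler_pdivrMr ?mulr_gt0 //.
  (* For x <= 16 the lower bound is nonpositive; beyond that the factor x - 16 is positive and the
     bound on [M] may be multiplied by it. *)
  have [x16|x16] := lerP x 16.
    apply: (@le_trans _ _ 0); first by rewrite mulr_le0_ge0 ?subr_le0 // ltW.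
    by rewrite !mulr_ge0 // ltW.
  apply: (@le_trans _ _ ((x - 16) * (x ^+ 2 * (x - 1)))).
    by rewrite ler_wpM2l // subr_ge0 ltW.
  apply: (@le_trans _ _ (x * (x - 3) * (x * (x + 1)))); last first.
    by rewrite ler_wpM2r // mulr_ge0 // ltW.
  rewrite -subr_ge0; have -> : x * (x - 3) * (x * (x + 1)) - (x - 16) * (x ^+ 2 * (x - 1)) =
    x ^+ 2 * (15 * x - 19) by ring.
  have x19 : 0 <= 15 * x - 19 by lra.
  by rewrite mulr_ge0 ?sqr_ge0.
rewrite ler_pdivrMr // mulrAC ler_pdivlMr ?mulr_gt0 //.
apply: (@le_trans _ _ (x * (x - 1) * ((x - 2) * (x - 3)))).
  by rewrite ler_wpM2r // mulr_ge0 // ltW.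
have x5 : 0 <= x + 5 by lra.
apply: (@le_trans _ _ ((x + 5) * (x ^+ 2 * (x - 3)))); last by rewrite ler_wpM2l.
rewrite -subr_ge0; have -> : (x + 5) * (x ^+ 2 * (x - 3)) - x * (x - 1) * ((x - 2) * (x - 3)) =
  x * (x - 3) * (8 * x - 2) by ring.
have x8 : 0 <= 8 * x - 2 by lra.
by rewrite !mulr_ge0 // ltW.
Qed.

(** * Reduction of the two cardinals to numbers of cubics *)

Section Counting.
Variables (F : finFieldType) (L : closedFieldType) (f : {rmorphism F -> L}).
Hypotheses (two : 2 != 0 :> F) (three : 3 != 0 :> F).

(** The pairs are partitioned by their cubic, and by [card_pairs] all fibres have the same size. *)
Lemma card_pencil_pairs (c : pred (F * F * F)) :
  (forall e, c e -> disc3 e != 0) ->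
  #|[set AB : 'M[F]_3 * 'M[F]_3 | [&& AB.1^T == AB.1, AB.2^T == AB.2 &
      (\det AB.1 != 0) && c (sinv AB.1 AB.2)]]| =
  (#|[set e | c e]| * #|[set g : 'M[F]_3 | (\det g != 0)%R]|)%N.
Proof.
move=> cD; rewrite -sum1_card.
rewrite (partition_big (fun AB => sinv AB.1 AB.2) c) /=; last first.
  by move=> AB; rewrite inE => /and4P[].
rewrite -sum1dep_card big_distrl /=; apply: eq_bigr => -[[e1 e2] e3] ce.
rewrite mul1n -(card_pairs f two (card_gt3 two three) (cD _ ce)) sum1dep_card.
apply: eq_card => AB; rewrite !inE -!andbA.
by case: eqP => // _; case: eqP => // _; case: (_ != 0) => //=;
  rewrite andbC; case: eqP => // ->; rewrite ce.
Qed.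

Lemma in_PsiP AB : in_Psi f AB <->
  [&& conic_rep AB.1, conic_rep AB.2 &
      (\det AB.1 != 0) && transverse (sinv AB.1 AB.2)].
Proof.
have two' : 2 != 0 :> L := two_neq0_map f two.
case: AB => A B; rewrite /in_Psi /nonsing_conic /transverse /=.
have key : conic_rep A -> conic_rep B -> \det A != 0 ->
    meet_in_four (map_mx f A) (map_mx f B) <-> disc3 (sinv A B) != 0.
  move=> /andP[/eqP sA _] /andP[/eqP sB _] dA.
  have fA : (map_mx f A)^T = map_mx f A by rewrite map_trmx sA.
  have fB : (map_mx f B)^T = map_mx f B by rewrite map_trmx sB.
  have dfA : \det (map_mx f A) != 0 by rewrite det_map_mx fmorph_eq0.
  have -> : (disc3 (sinv A B) != 0) = (disc3 (sinv (map_mx f A) (map_mx f B)) != 0).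
    by rewrite sinv_map disc3_map fmorph_eq0.
  by split; [exact: meet_in_four_disc | exact: disc_meet_in_four].
rewrite /sinv /= in key *; split.
  move=> [/andP[cA dA] /andP[cB dB] m]; rewrite cA cB dA /=; apply/andP; split.
    by rewrite mulf_neq0 // invr_eq0.
  exact/key.
move=> /and5P[cA cB dA s0 /(key cA cB dA) m]; rewrite cA cB dA; split=> //=.
by apply: contraNneq s0 => dB; rewrite /s3 dB mul0r.
Qed.

(** Both directions of the Cayley criterion are applied over the closure; the condition descends
    because [f] is injective. *)
Lemma in_GammaP AB : in_Gamma f AB <->
  [&& conic_rep AB.1, conic_rep AB.2 &
      (\det AB.1 != 0) && (transverse (sinv AB.1 AB.2) && cayley (sinv AB.1 AB.2))].
Proof.
have two' : 2 != 0 :> L := two_neq0_map f two.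
case: AB => A B; rewrite /in_Gamma.
have key : in_Psi f (A, B) ->
    poncelet_triangle (map_mx f A) (map_mx f B) <-> cayley (sinv A B).
  move=> [/andP[/andP[/eqP sA _] dA] /andP[/andP[/eqP sB _] dB] m]; rewrite /= in sA sB dA dB m.
  have fA : (map_mx f A)^T = map_mx f A by rewrite map_trmx sA.
  have fB : (map_mx f B)^T = map_mx f B by rewrite map_trmx sB.
  have dfA : \det (map_mx f A) != 0 by rewrite det_map_mx fmorph_eq0.
  have dfB : \det (map_mx f B) != 0 by rewrite det_map_mx fmorph_eq0.
  have D0 := meet_in_four_disc two' fA fB dfA m.
  have -> : cayley (sinv A B) = cayley (sinv (map_mx f A) (map_mx f B)).
    by rewrite sinv_map cayley_map.
  by split; [exact: poncelet_cayley | exact: cayley_poncelet].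
split=> [[m t]|].
  have /in_PsiP/and4P[/= -> -> -> ->] := m; exact/key.
move=> /and5P[/= cA cB dA tr C]; have m : in_Psi f (A, B).
  by apply/in_PsiP; rewrite /= cA cB dA.
by split=> //; apply/key.
Qed.

(** Instantiated once for Psi and once for Gamma, this puts the same factors in front of both
    counts, so that they cancel in the ratio. *)
Lemma card_ratio_pairs (c : pred (F * F * F)) :
  (forall e, c e -> transverse e) ->
  (forall r e1 e2 e3, r != 0 ->
     c (r * e1, r ^+ 2 * e2, r ^+ 3 * e3) = c (e1, e2, e3)) ->
  (#|F|.-1 * #|F|.-1 *
   #|[set AB : 'M[F]_3 * 'M[F]_3 | [&& conic_rep AB.1, conic_rep AB.2 &
      (\det AB.1 != 0)%R && c (sinv AB.1 AB.2)]]| =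
  #|[set e | c e]| * #|[set g : 'M[F]_3 | (\det g != 0)%R]|)%N.
Proof.
move=> cT cZ; rewrite -card_pencil_pairs; last by move=> e /cT/andP[].
rewrite -card_conic_pairs // => [A B | x y A B x0 y0] /=.
  move=> /andP[dA /cT/andP[dB _]]; split.
    by apply: contraNneq dA => ->; rewrite -(scale0r (1%:M)) detZ expr0n mul0r.
  apply: contraNneq dB => ->; rewrite /sinv /s3 /=.
  by rewrite -(scale0r (1%:M)) detZ expr0n !mul0r.
rewrite detZ mulf_eq0 expf_eq0 (negPf x0) /=.
have [//|dA] := eqVneq (\det A) 0; rewrite (sinv_scale two y B x0 dA) /=.
by rewrite cZ // mulf_neq0 // invr_eq0.
Qed.

End Counting.

Theorem theorem2p1 (F : finFieldType) (L : closedFieldType)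
  (f : {rmorphism F -> L})
  (L_alg : forall x : L, exists p : {poly F}, p != 0 /\ root (map_poly f p) x)
  (char2 : (2 \notin [pchar F])%N) (char3 : (3 \notin [pchar F])%N)
  (Psi Gamma : {set 'M[F]_3 * 'M[F]_3})
  (HPsi : forall AB, AB \in Psi <-> in_Psi f AB)
  (HGamma : forall AB, AB \in Gamma <-> in_Gamma f AB) :
  let q : rat := (#|F|)%:R in
  (q - 16) / (q * (q + 1)) <= (#|Gamma|)%:R / (#|Psi|)%:R /\
  (#|Gamma|)%:R / (#|Psi|)%:R <= (q + 5) / ((q - 2) * (q - 3)).
Proof.
have two : 2 != 0 :> F by move: char2; rewrite inE.
have three : 3 != 0 :> F by move: char3; rewrite inE.
have q3 := card_gt3 two three.
have EPsi : Psi = [set AB | [&& conic_rep AB.1, conic_rep AB.2 &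
    (\det AB.1 != 0) && transverse (sinv AB.1 AB.2)]].
  apply/setP=> AB; rewrite inE; apply/idP/idP=> [/HPsi/(in_PsiP f two)//|].
  by move/(in_PsiP f two)/HPsi.
have EGamma : Gamma = [set AB | [&& conic_rep AB.1, conic_rep AB.2 &
    (\det AB.1 != 0) && (transverse (sinv AB.1 AB.2) && cayley (sinv AB.1 AB.2))]].
  apply/setP=> AB; rewrite inE; apply/idP/idP=> [/HGamma/(in_GammaP f two)//|].
  by move/(in_GammaP f two)/HGamma.
have trZ (r e1 e2 e3 : F) : r != 0 ->
    transverse (r * e1, r ^+ 2 * e2, r ^+ 3 * e3) = transverse (e1, e2, e3).
  move=> r0; rewrite /transverse disc3_scale /=.
  by rewrite !(expf_eq0, mulf_eq0) (negPf r0).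
have CPsi := card_ratio_pairs f two three (fun e => id) trZ.
have CGamma := @card_ratio_pairs F L f two three (fun e => transverse e && cayley e)
  (fun e => @proj1 _ _ \o andP) (fun r e1 e2 e3 r0 =>
     congr2 andb (trZ r e1 e2 e3 r0) (cayley_scale e1 e2 e3 r0)).
rewrite -EPsi in CPsi; rewrite -EGamma in CGamma => q.
set g := #|[set g : 'M[F]_3 | _]| in CPsi CGamma.
have g0 : (0 < g)%N.
  by apply/card_gt0P; exists 1%:M; rewrite inE det1 oner_eq0.
have k0 : (0 < #|F|.-1 * #|F|.-1)%N by rewrite muln_gt0 -subn1 subn_gt0 (ltn_trans _ q3).
move: (#|F|.-1 * #|F|.-1)%N k0 CPsi CGamma => k k0 CPsi CGamma.
have -> : #|Gamma|%:R / #|Psi|%:R =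
    #|[set e : F * F * F | transverse e && cayley e]|%:R /
    #|[set e : F * F * F | transverse e]|%:R :> rat.
  (* Expanding by the positive number [k] makes both counting identities applicable; the order of
     GL_3, here [g], then cancels. *)
  transitivity ((k * #|Gamma|)%:R / (k * #|Psi|)%:R : rat).
    by rewrite !natrM -mulf_div divff ?mul1r // pnatr_eq0 -lt0n.
  by rewrite CPsi CGamma !natrM -mulf_div divff ?mulr1 // pnatr_eq0 -lt0n.
have q1 : (1 <= #|F|)%N by apply: leq_trans q3.
apply: ratio_bounds.
- by rewrite /q (ler_nat _ 4).
- exact: ler0n.
- by rewrite /q -(natrB _ (ltnW q3)) -natrM ler_nat card_cayley_ge.
- by rewrite /q -(natrB _ q1) -natrM ler_nat card_cayley_le.
- by rewrite /q -(natrB _ (ltnW q3)) -natrX -natrM ler_nat card_transverse_ge.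
- by rewrite /q -(natrB _ q1) -natrX -natrM ler_nat card_transverse_le.
Qed.
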